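(* Let $\Bbbk$ be a field, let $m\ge2$ be an integer, let $A$ be an $m$-homogeneous algebra over $\Bbbk$ and let $\tau=\{\tau_i:i\in\mathbb Z\}$ be a twisting system of $A$. Then the Zhang twist $A^\tau$ is a 2-cocycle twist of $A$ by some 2-cocycle on its universal quantum group: there is a right 2-cocycle $\sigma$ on the right universal quantum group $\underline{\mathrm{aut}}^r(A)$ such that $A^\tau\cong A_\sigma$ as graded algebras.
   Context: All algebras are over $\Bbbk$ and $\otimes=\otimes_\Bbbk$. A $\mathbb Z$-graded algebra $A$ is connected graded if $A_i=0$ for $i<0$ and $A_0=\Bbbk$. For $m\ge2$, an $m$-homogeneous algebra is a connected graded algebra $A=\Bbbk\langle A_1\rangle/(R)$ finitely generated in degree one, with $\Bbbk\langle A_1\rangle$ the free (tensor) algebra on $A_1$ and $R\subseteq A_1^{\otimes m}$. A twisting system of a $\mathbb Z$-graded algebra $A$ is a collection $\tau=\{\tau_i:i\in\mathbb Z\}$ of graded (degree-preserving) bijective linear maps $\tau_i:A\to A$ with $\tau_i(a\tau_j(b))=\tau_i(a)\tau_{i+j}(b)$ for all $i,j$, all $a\in A_j$ and homogeneous $b\in A$; it is always assumed that $\tau_i(1)=1$ for all $i$ and $\tau_0=\mathrm{id}_A$. The right Zhang twist $A^\tau$ is $A$ as a graded vector space with product $a\cdot_\tau b=a\tau_j(b)$ for $a\in A_j$, $b\in A$ homogeneous. Universal quantum group: a Hopf algebra $K$ right coacts on $A$ preserving the grading if $A$ is a right $K$-comodule algebra via $A\to A\otimes K$ mapping each $A_i$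 into $A_i\otimes K$. $\underline{\mathrm{aut}}^r(A)$ is the Hopf algebra right coacting on $A$ preserving the grading via $\rho$, such that for every Hopf algebra $K$ right coacting on $A$ preserving the grading via $\tau'$ there is a unique Hopf algebra map $f:\underline{\mathrm{aut}}^r(A)\to K$ with $(\mathrm{id}\otimes f)\rho=\tau'$. A right 2-cocycle on a Hopf algebra $H$ is a convolution invertible linear map $\sigma:H\otimes H\to\Bbbk$ with $\sum\sigma(x_1y_1,z)\sigma(x_2,y_2)=\sum\sigma(x,y_1z_1)\sigma(y_2,z_2)$ and $\sigma(x,1)=\sigma(1,x)=\varepsilon(x)$ for all $x,y,z\in H$ (Sweedler notation $\Delta(h)=\sum h_1\otimes h_2$). For a graded right $H$-comodule algebra $A$ with coaction $a\mapsto\sum a_0\otimes a_1\in A\otimes H$, the 2-cocycle twist $A_\sigma$ is $A$ as a graded vector space with product $a\cdot_\sigma b=\sum a_0b_0\,\sigma(a_1,b_1)$. *)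

(* Defs.v *)
From HB Require Import structures.
From mathcomp Require Import all_boot all_algebra.
From mathcomp Require Import boolp classical_sets functions cardinality fsbigop.
From mathcomp Require Import finmap monalg.

Set Implicit Arguments.
Unset Strict Implicit.
Unset Printing Implicit Defensive.

Import GRing.Theory.
Local Open Scope quotient_scope.
Local Open Scope ring_scope.

Section LinearForm.
Variables (k : fieldType) (U : lmodType k).

Let subsp (S : set U) := S 0 /\ forall (a : k) x y, S x -> S y -> S (a *: x + y).

Lemma exists_linear_form (u : U) : u != 0 ->
  exists phi : {linear U -> k^o}, phi u = 1.
Proof.
move=> u0; pose P (S : set U) := subsp (S `|` [set 0]) /\ ~ S u.
have [F FP tF|S [[[sS0 sS] Su] maxS]] := @Zorn_bigcup U P.
  split; last by case=> S FS; apply: (FP S FS).2.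
  split; first by right.
  have F0 S x : F S -> (S `|` [set 0])%classic x ->
      ((\bigcup_(i in F) i) `|` [set 0])%classic x.
    by move=> FS [Sx|->]; [left; exists S|right].
  move=> a x y [[S FS Sx]|->] [[T FT Ty]|->].
  - have [ST|TS] := tF S T FS FT.
      by apply: (F0 T) => //; apply: (FP T FT).1.2; left => //; apply: ST.
    by apply: (F0 S) => //; apply: (FP S FS).1.2; left => //; apply: TS.
  - by apply: (F0 S) => //; apply: (FP S FS).1.2; [left|right].
  - by rewrite scaler0 add0r; left; exists T.
  - by rewrite scaler0 add0r; right.
pose S' := (S `|` [set 0])%classic.
have S'0 : S' 0 by right.
have S'u : ~ S' u by case=> // /eqP; apply/negP.
have S'Z a x : S' x -> S' (a *: x).
  by move=> Sx; rewrite -[_ *: _]addr0; apply: sS => //; right.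
have S'D x y : S' x -> S' y -> S' (x + y).
  by move=> Sx Sy; rewrite -[x]scale1r; apply: sS.
have S'B x y : S' x -> S' y -> S' (x - y).
  by move=> Sx Sy; apply: S'D => //; rewrite -scaleN1r; apply: S'Z.
have dec x : exists c : k, S' (x - c *: u).
  have [Sx|Sx] := pselect (S' x); first by exists 0; rewrite scale0r subr0.
  apply: contrapT => nc.
  pose T := [set y | exists2 z, S' z & exists c : k, y = z + c *: x]%classic.
  have ST : (S `<=` T)%classic.
    by move=> y Sy; exists y; [left|exists 0; rewrite scale0r addr0].
  apply: (maxS T).
    rewrite properEneq; split => //; apply/eqP => ET; apply: Sx; left; rewrite ET.
    by exists 0 => //; exists 1; rewrite scale1r add0r.
  split.
    have T0 : T 0 by exists 0 => //; exists 0; rewrite scale0r addr0.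
    rewrite (_ : (T `|` [set 0])%classic = T); last first.
      by apply/seteqP; split=> y; [case=> // ->|left].
    split=> // a _ _ [z Sz [c ->]] [z' Sz' [c' ->]].
    exists (a *: z + z'); first exact: sS.
    exists (a * c + c'); rewrite scalerDr scalerDl scalerA.
    by rewrite !addrA; congr (_ + _); rewrite addrAC.
  case=> z Sz [c uE]; apply: nc; exists c^-1.
  have c0 : c != 0.
    by apply/eqP => c0; apply: S'u; rewrite uE c0 scale0r addr0.
  rewrite uE scalerDr scalerA mulVf // scale1r opprD addrCA subrr addr0.
  by rewrite -scaleN1r; exact/S'Z/S'Z.
have uniq c d x : S' (x - c *: u) -> S' (x - d *: u) -> c = d.
  move=> Sc Sd; apply/eqP; rewrite -subr_eq0; apply/negPn/negP => cd.
  apply: S'u; have := S'Z (c - d)^-1 _ (S'B _ _ Sd Sc).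
  rewrite [X in _ *: X](_ : _ = (c - d) *: u); last first.
    by rewrite scalerBl opprB addrC addrA subrK.
  by rewrite scalerA mulVf // scale1r.
pose phi x : k^o := projT1 (cid (dec x)).
have phiP x : S' (x - phi x *: u) by rewrite /phi; case: cid.
have philin : linear phi.
  move=> a x y; apply: (uniq _ _ _ (phiP _)).
  have := sS a _ _ (phiP x) (phiP y).
  by rewrite scalerBr scalerA addrACA -opprD -scalerDl.
pose f : {linear U -> k^o} :=
  HB.pack phi (GRing.isLinear.Build k U k^o *:%R phi philin).
exists f; apply: (uniq _ _ u (phiP u)); by rewrite scale1r subrr.
Qed.

End LinearForm.

(* U (x) V is the type of formal sums of pairs (u, v), two of them being
   identified when every bilinear map gives them the same value; the universal
   property is tsum_pi, tsum_tens and tsum_is_linear below. *)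
Section TensorDef.
Variables (k : fieldType) (U V : lmodType k).

Definition tensor_equiv : rel (seq (U * V)) := fun s t =>
  `[< forall (W : lmodType k) (f : {bilinear U -> V -> W}),
        \sum_(p <- s) f p.1 p.2 = \sum_(p <- t) f p.1 p.2 >].

Fact tensor_equiv_refl : reflexive tensor_equiv.
Proof. by move=> s; apply/asboolP. Qed.

Fact tensor_equiv_sym : symmetric tensor_equiv.
Proof.
by move=> s t; apply/asboolP/asboolP => st W f; apply: esym; apply: st.
Qed.

Fact tensor_equiv_trans : transitive tensor_equiv.
Proof.
move=> t s r /asboolP st /asboolP tr; apply/asboolP => W f.
exact: etrans (st W f) (tr W f).
Qed.

Canonical tensor_equiv_rel :=
  EquivRel tensor_equiv tensor_equiv_refl tensor_equiv_sym tensor_equiv_trans.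

Definition tensor := {eq_quot tensor_equiv_rel}.
HB.instance Definition _ := Choice.on tensor.
HB.instance Definition _ := EqQuotient.on tensor.

Definition tens (u : U) (v : V) : tensor := \pi_tensor [:: (u, v)].

(* The sum of the F u v over the terms u (x) v of t: when F is bilinear, this
   does not depend on the way t is written, and tsum F is the linear map
   induced by F. *)
Definition tsum (W : nmodType) (F : U -> V -> W) (t : tensor) : W :=
  \sum_(p <- repr t) F p.1 p.2.

End TensorDef.

Notation "u ⊗ v" := (tens u v) (at level 40, left associativity) : ring_scope.

Notation bilin F := (bilinear_for *:%R *:%R F).

Section TensorLmod.
Variables (k : fieldType) (U V : lmodType k).
Local Notation T := (tensor U V).

Lemma tsum_pi (W : lmodType k) (F : U -> V -> W) s : bilin F ->
  tsum F (\pi_T s) = \sum_(p <- s) F p.1 p.2.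
Proof.
move=> bF.
pose f : {bilinear U -> V -> W} :=
  HB.pack F (bilinear_isBilinear.Build k U V W *:%R *:%R F bF).
rewrite /tsum; case: piP => t /eqmodP /asboolP /(_ W f) /= H.
by rewrite -[LHS]H.
Qed.

Lemma tsum_tens (W : lmodType k) (F : U -> V -> W) u v : bilin F ->
  tsum F (u ⊗ v) = F u v.
Proof. by move=> bF; rewrite tsum_pi // big_seq1. Qed.

Lemma tensor_ext (x y : T) :
  (forall (W : lmodType k) (F : U -> V -> W), bilin F -> tsum F x = tsum F y) ->
  x = y.
Proof.
move=> xy; rewrite -[x]reprK -[y]reprK; apply/eqmodP/asboolP => W f.
by apply: (xy W f); split => z a u v; rewrite ?linearPl ?linearPr.
Qed.

Let tadd (x y : T) : T := \pi_T (repr x ++ repr y).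
Let topp (x : T) : T := \pi_T [seq (- p.1, p.2) | p <- repr x].
Let tscale (a : k) (x : T) : T := \pi_T [seq (a *: p.1, p.2) | p <- repr x].
Let t0 : T := \pi_T [::].

Section W.
Variables (W : lmodType k) (F : U -> V -> W) (bF : bilin F).

Let f : {bilinear U -> V -> W} :=
  HB.pack F (bilinear_isBilinear.Build k U V W *:%R *:%R F bF).

Let tsum_t0 : tsum F t0 = 0.
Proof. by rewrite tsum_pi // big_nil. Qed.

Let tsum_tadd x y : tsum F (tadd x y) = tsum F x + tsum F y.
Proof. by rewrite tsum_pi // big_cat. Qed.

Let tsum_tscale a x : tsum F (tscale a x) = a *: tsum F x.
Proof.
rewrite tsum_pi // big_map scaler_sumr; apply: eq_bigr => p _ /=.
exact: (linearZl_LR f).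
Qed.

Let tsum_topp x : tsum F (topp x) = - tsum F x.
Proof.
rewrite tsum_pi // big_map -sumrN; apply: eq_bigr => p _ /=.
exact: (linearNl f).
Qed.

Definition tsumE := (tsum_t0, tsum_tadd, tsum_tscale, tsum_topp).
End W.

Fact taddA : associative tadd.
Proof. by move=> x y z; apply: tensor_ext => W F bF; rewrite !tsumE// addrA. Qed.
Fact taddC : commutative tadd.
Proof. by move=> x y; apply: tensor_ext => W F bF; rewrite !tsumE// addrC. Qed.
Fact tadd0 : left_id t0 tadd.
Proof. by move=> x; apply: tensor_ext => W F bF; rewrite !tsumE// add0r. Qed.
Fact taddN : left_inverse t0 topp tadd.
Proof. by move=> x; apply: tensor_ext => W F bF; rewrite !tsumE// addNr. Qed.

HB.instance Definition _ :=
  GRing.isZmodule.Build (tensor U V) taddA taddC tadd0 taddN.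

Fact tscaleA a b x : tscale a (tscale b x) = tscale (a * b) x.
Proof. by apply: tensor_ext => W F bF; rewrite !tsumE// scalerA. Qed.
Fact tscale1 : left_id 1 tscale.
Proof. by move=> x; apply: tensor_ext => W F bF; rewrite !tsumE// scale1r. Qed.
Fact tscaleDr : right_distributive tscale +%R.
Proof.
by move=> a x y; apply: tensor_ext => W F bF; rewrite !tsumE// scalerDr.
Qed.
Fact tscaleDl x : {morph tscale^~ x : a b / a + b}.
Proof.
by move=> a b; apply: tensor_ext => W F bF; rewrite !tsumE// scalerDl.
Qed.

HB.instance Definition _ := GRing.Zmodule_isLmodule.Build k (tensor U V)
  tscaleA tscale1 tscaleDr tscaleDl.

Lemma tsum_is_linear (W : lmodType k) (F : U -> V -> W) : bilin F ->
  linear (tsum F : T -> W).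
Proof. by move=> bF a x y; rewrite !tsumE. Qed.

Lemma tens_bilin : bilin (@tens k U V).
Proof.
split=> [v a u u'|u a v v']; apply: tensor_ext => W F bF;
  rewrite tsum_is_linear// !tsum_tens//; [exact: bF.1|exact: bF.2].
Qed.

Lemma tensor_sum (x : T) : x = tsum (@tens k U V) x.
Proof.
have b := tens_bilin; apply: tensor_ext => W F bF.
pose f : {linear T -> W} :=
  HB.pack (tsum F) (GRing.isLinear.Build k T W *:%R (tsum F) (tsum_is_linear bF)).
rewrite [RHS](_ : _ = f (tsum (@tens k U V) x))// {2}/tsum linear_sum.
by apply: eq_bigr => p _ /=; rewrite tsum_tens//; case: p.
Qed.

Lemma tensor_ind (P : T -> Prop) :
  P 0 -> (forall u v, P (u ⊗ v)) -> (forall x y, P x -> P y -> P (x + y)) ->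
  forall x, P x.
Proof. by move=> P0 P1 PD x; rewrite [x]tensor_sum; apply: big_ind. Qed.

End TensorLmod.

Section LinearRules.
Variable k : fieldType.
Implicit Types U V W X : lmodType k.

Lemma lin_id U : linear (fun x : U => x). Proof. by []. Qed.

Lemma lin_Z U V (f : U -> V) (c : k) x : linear f -> f (c *: x) = c *: f x.
Proof.
move=> lf; pose f' : {linear U -> V} :=
  HB.pack f (GRing.isLinear.Build k U V *:%R f lf).
exact: (linearZ_LR f').
Qed.

Lemma lin_app U V W (f : {linear V -> W}) (g : U -> V) :
  linear g -> linear (fun x => f (g x)).
Proof. by move=> lg a x y; rewrite lg linearP. Qed.

Lemma lin_scaler U V (c : k) (g : U -> V) :
  linear g -> linear (fun x => c *: g x).
Proof. by move=> lg a x y; rewrite lg scalerDr !scalerA mulrC. Qed.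

Lemma lin_scalel U V (g : U -> k^o) (v : V) :
  linear g -> linear (fun x => (g x : k) *: v).
Proof. by move=> lg a x y; rewrite lg scalerDl scalerA. Qed.

Lemma lin_mull U (A : algType k) (g : U -> A) (b : A) :
  linear g -> linear (fun x => g x * b).
Proof. by move=> lg a x y; rewrite lg mulrDl scalerAl. Qed.

Lemma lin_mulr U (A : algType k) (g : U -> A) (b : A) :
  linear g -> linear (fun x => b * g x).
Proof. by move=> lg a x y; rewrite lg mulrDr scalerAr. Qed.

Lemma lin_sum U V (I : Type) (r : seq I) (F : I -> U -> V) :
  (forall i, linear (F i)) -> linear (fun x => \sum_(i <- r) F i x).
Proof.
move=> lF a x y; rewrite scaler_sumr -big_split /=.
by apply: eq_bigr => i _; rewrite lF.
Qed.

Lemma lin_tsum_param U V W X (F : X -> U -> V -> W) t :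
  (forall u v, linear (fun x => F x u v)) -> linear (fun x => tsum (F x) t).
Proof. by move=> lF; apply: lin_sum => p; apply: lF. Qed.

Lemma lin_tsum U V W X (F : U -> V -> W) (g : X -> tensor U V) :
  bilin F -> linear g -> linear (fun x => tsum F (g x)).
Proof. by move=> bF lg a x y; rewrite lg tsum_is_linear. Qed.

Lemma lin_tensl U V W (g : W -> U) (v : V) :
  linear g -> linear (fun x => g x ⊗ v).
Proof. by move=> lg a x y; rewrite lg (tens_bilin U V).1. Qed.

Lemma lin_tensr U V W (u : U) (g : W -> V) :
  linear g -> linear (fun x => u ⊗ g x).
Proof. by move=> lg a x y; rewrite lg (tens_bilin U V).2. Qed.

End LinearRules.

Ltac lin := cbv beta;
  match goal with
  | |- linear_for _ (fun x => x) => apply lin_id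
  | H : linear_for _ ?f |- linear_for _ ?f => exact H
  | |- forall _, _ => intro; lin
  | |- prod _ _ => split; lin
  | |- bilinear_for _ _ _ => split; lin
  | |- _ => first
    [ solve [done]
    | match goal with H : _ |- _ => solve [apply: H] end
    | solve [apply: lin_tensl; lin] | solve [apply: lin_tensr; lin]
    | solve [apply: lin_mull; lin] | solve [apply: lin_mulr; lin]
    | solve [apply: lin_scalel; lin] | solve [apply: lin_scaler; lin]
    | solve [apply: lin_tsum_param; lin]
    | solve [apply: lin_tsum; lin]
    | solve [apply: lin_app; lin] ]
  end.

Section TensorTheory.
Variable k : fieldType.
Implicit Types U V W X : lmodType k.

Lemma tsum0 U V W (F : U -> V -> W) : bilin F -> tsum F 0 = 0.
Proof.
move=> bF; have := tsum_is_linear bF 1 0 0.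
by rewrite scale1r addr0 scale1r => /eqP; rewrite -subr_eq0 opprD addNKr oppr_eq0 => /eqP.
Qed.

Lemma tsumD U V W (F : U -> V -> W) x y : bilin F ->
  tsum F (x + y) = tsum F x + tsum F y.
Proof. by move=> bF; rewrite -[x]scale1r tsum_is_linear ?scale1r. Qed.

Lemma tsum_sum U V W (F : U -> V -> W) I (r : seq I) (x : I -> tensor U V) :
  bilin F -> tsum F (\sum_(i <- r) x i) = \sum_(i <- r) tsum F (x i).
Proof.
move=> bF; elim/big_ind2: _ => //; first exact: tsum0.
by move=> x1 ? y1 ? <- <-; exact: tsumD.
Qed.

Lemma eq_tsum U V (W : nmodType) (F G : U -> V -> W) t :
  (forall u v, F u v = G u v) -> tsum F t = tsum G t.
Proof. by move=> FG; apply: eq_bigr => p _. Qed.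

Lemma linear_tsum U V W X (f : W -> X) (F : U -> V -> W) t :
  linear f -> f (tsum F t) = tsum (fun u v => f (F u v)) t.
Proof.
move=> lf; pose f' : {linear W -> X} :=
  HB.pack f (GRing.isLinear.Build k W X *:%R f lf).
exact: (linear_sum f').
Qed.

Lemma tensor_eq U V W (f g : tensor U V -> W) : linear f -> linear g ->
  (forall u v, f (u ⊗ v) = g (u ⊗ v)) -> forall t, f t = g t.
Proof.
move=> lf lg fg t; rewrite [t]tensor_sum !linear_tsum//.
by apply: eq_tsum.
Qed.

Lemma exchange_tsum U V U' V' (W : nmodType)
    (F : U -> V -> U' -> V' -> W) t t' :
  tsum (fun u v => tsum (fun u' v' => F u v u' v') t') t =
  tsum (fun u' v' => tsum (fun u v => F u v u' v') t) t'.
Proof. exact: exchange_big. Qed.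

(* f (x) g *)
Definition tmap U U' V V' (f : U -> U') (g : V -> V') :
  tensor U V -> tensor U' V' := tsum (fun u v => f u ⊗ g v).

(* the isomorphism (U (x) V) (x) W -> U (x) (V (x) W) *)
Definition tassoc U V W :
  tensor (tensor U V) W -> tensor U (tensor V W) :=
  tsum (fun t w => tsum (fun u v => u ⊗ (v ⊗ w)) t).

Lemma tens_neq0 U V (u : U) (v : V) : u != 0 -> v != 0 -> u ⊗ v != 0.
Proof.
move=> /exists_linear_form[f fu] /exists_linear_form[g gv].
apply/eqP => /(congr1 (tsum (fun u v => (f u : k) *: g v))).
have bF : bilin (fun u v => (f u : k) *: g v) by lin.
rewrite tsum0// tsum_tens// fu gv scale1r => /eqP.
by rewrite oner_eq0.
Qed.

End TensorTheory.

Section TensorAlg.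
Variables (k : fieldType) (A B : algType k).
Local Notation T := (tensor A B).

(* (a (x) b) (a' (x) b') = a a' (x) b b' *)
Definition tmul (x y : T) : T :=
  tsum (fun a b => tsum (fun a' b' => (a * a') ⊗ (b * b')) y) x.

Definition tone : T := 1 ⊗ 1.

Fact tmul_linl y : linear (tmul^~ y).
Proof. by rewrite /tmul; lin. Qed.
Fact tmul_linr x : linear (tmul x).
Proof. by rewrite /tmul; lin. Qed.
Lemma tmul_tens a b a' b' : tmul (a ⊗ b) (a' ⊗ b') = (a * a') ⊗ (b * b').
Proof. by rewrite /tmul !tsum_tens//; lin. Qed.

Fact tmulA : associative tmul.
Proof.
have ll := tmul_linl; have lr := tmul_linr.
move=> x y z; move: x; apply: tensor_eq.
- exact: ll.
- by move=> c u v; rewrite !ll.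
move=> a b; move: y; apply: tensor_eq.
- by move=> c u v; rewrite ll !lr.
- by move=> c u v; rewrite lr !ll.
move=> a' b'; move: z; apply: tensor_eq.
- by move=> c u v; rewrite !lr.
- exact: lr.
by move=> a'' b''; rewrite !tmul_tens !mulrA.
Qed.

Fact tmul1x : left_id tone tmul.
Proof.
apply: tensor_eq; [exact: tmul_linr|exact: lin_id|].
by move=> a b; rewrite tmul_tens !mul1r.
Qed.

Fact tmulx1 : right_id tone tmul.
Proof.
apply: tensor_eq; [exact: tmul_linl|exact: lin_id|].
by move=> a b; rewrite tmul_tens !mulr1.
Qed.

Fact tmulDl : left_distributive tmul +%R.
Proof. by move=> x y z; rewrite -[x]scale1r tmul_linl !scale1r. Qed.

Fact tmulDr : right_distributive tmul +%R.
Proof. by move=> z x y; rewrite -[x]scale1r tmul_linr !scale1r. Qed.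

Fact tone_neq0 : tone != 0.
Proof. by apply: tens_neq0; apply: oner_neq0. Qed.

HB.instance Definition _ := GRing.Zmodule_isNzRing.Build (tensor A B)
  tmulA tmul1x tmulx1 tmulDl tmulDr tone_neq0.

Fact tscaleAl (c : k) (x y : T) : c *: (x * y) = (c *: x) * y.
Proof. exact/esym/(lin_Z _ _ (tmul_linl y)). Qed.

HB.instance Definition _ :=
  GRing.Lmodule_isLalgebra.Build k (tensor A B) tscaleAl.

Fact tscaleAr (c : k) (x y : T) : c *: (x * y) = x * (c *: y).
Proof. exact/esym/(lin_Z _ _ (tmul_linr x)). Qed.

HB.instance Definition _ :=
  GRing.Lalgebra_isAlgebra.Build k (tensor A B) tscaleAr.

Lemma tensM (a a' : A) (b b' : B) :
  (a ⊗ b) * (a' ⊗ b') = (a * a') ⊗ (b * b').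
Proof. exact: tmul_tens. Qed.

Lemma tsumM (W : lmodType k) (F : A -> B -> W) (x y : T) : bilin F ->
  tsum F (x * y) =
  tsum (fun a b => tsum (fun a' b' => F (a * a') (b * b')) y) x.
Proof.
move=> bF; rewrite [x * y]/(tmul x y) /tmul.
have lF := tsum_is_linear bF.
rewrite (linear_tsum _ _ lF); apply: eq_tsum => a b.
by rewrite (linear_tsum _ _ lF); apply: eq_tsum => a' b'; rewrite tsum_tens.
Qed.

End TensorAlg.

Section Hopf.
Variable k : fieldType.

Record hopfAlg := HopfAlg {
  hopf_sort :> algType k;
  comul : {lrmorphism hopf_sort -> tensor hopf_sort hopf_sort};
  counit : {lrmorphism hopf_sort -> k^o};
  antipode : {linear hopf_sort -> hopf_sort};
  comulA : forall h,
    tassoc (tmap comul idfun (comul h)) = tmap idfun comul (comul h);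
  counitl : forall h, tsum (fun h1 h2 => (counit h1 : k) *: h2) (comul h) = h;
  counitr : forall h, tsum (fun h1 h2 => (counit h2 : k) *: h1) (comul h) = h;
  antipodel : forall h,
    tsum (fun h1 h2 => antipode h1 * h2) (comul h) = (counit h : k)%:A;
  antipoder : forall h,
    tsum (fun h1 h2 => h1 * antipode h2) (comul h) = (counit h : k)%:A
}.

Definition is_hopf_morphism (H K : hopfAlg) (f : {lrmorphism H -> K}) : Prop :=
  [/\ forall h, comul K (f h) = tmap f f (comul H h),
      forall h, counit K (f h) = counit H h &
      forall h, antipode K (f h) = f (antipode H h)].

(* sigma (x (x) y) stands for sigma(x, y) *)
Definition convolution_inverse (H : hopfAlg)
    (sigma sigma' : {linear tensor H H -> k^o}) : Prop :=
  forall x y : H,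
    tsum (fun x1 x2 => tsum (fun y1 y2 =>
        sigma (x1 ⊗ y1) * sigma' (x2 ⊗ y2)) (comul H y)) (comul H x)
    = counit H x * counit H y.

Record cocycle (H : hopfAlg) := Cocycle {
  cocycle_form :> {linear tensor H H -> k^o};
  cocycle_invertible : exists sigma' : {linear tensor H H -> k^o},
    convolution_inverse cocycle_form sigma' /\
    convolution_inverse sigma' cocycle_form;
  cocycleP : forall x y z : H,
    tsum (fun x1 x2 => tsum (fun y1 y2 =>
        cocycle_form ((x1 * y1) ⊗ z) * cocycle_form (x2 ⊗ y2))
      (comul H y)) (comul H x)
    = tsum (fun y1 y2 => tsum (fun z1 z2 =>
        cocycle_form (x ⊗ (y1 * z1)) * cocycle_form (y2 ⊗ z2))
      (comul H z)) (comul H y);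
  cocycle1r : forall x : H, cocycle_form (x ⊗ 1) = counit H x;
  cocycle1l : forall x : H, cocycle_form (1 ⊗ x) = counit H x
}.

End Hopf.

Section Graded.
Variable k : fieldType.

(* A Z-grading is given by its projections: A_i is the set of the a such that
   gcomp i a = a, and gcomp i a is the component of degree i of a. *)
Record gradedAlg := GradedAlg {
  graded_sort :> algType k;
  gcomp : int -> {linear graded_sort -> graded_sort};
  gcomp_id : forall i j a,
    gcomp i (gcomp j a) = if i == j then gcomp j a else 0;
  gcomp_fin : forall a, finite_set [set i | gcomp i a != 0];
  gcomp_sum : forall a, \sum_(i \in [set: int]) gcomp i a = a;
  gcomp_mul : forall i j a b, gcomp i a = a -> gcomp j b = b ->
    gcomp (i + j) (a * b) = a * b;
  gcomp_one : gcomp 0 1 = 1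
}.

Definition homog (A : gradedAlg) (i : int) : set A := [set a | gcomp A i a = a].
Arguments homog : clear implicits.

Definition graded_iso (A B : gradedAlg) : Prop :=
  exists phi : {lrmorphism A -> B},
    bijective phi /\ forall i a, homog A i a -> homog B i (phi a).

Definition connected (A : gradedAlg) : Prop :=
  (forall i a, i < 0 -> homog A i a -> a = 0) /\
  (forall a, homog A 0 a -> exists c : k, a = c%:A).

(* the free algebra on n generators; words are monomials of {fmonom 'I_n} *)
Definition free_alg (n : nat) := {malg k[{fmonom 'I_n}]}.

Definition free_eval (A : algType k) (n : nat) (x : 'I_n -> A) :
    free_alg n -> A :=
  mmap (fun c : k => c%:A) (fun w : {fmonom 'I_n} => \prod_(i <- w) x i).

Definition two_sided_ideal (B : nzRingType) (R : set B) : set B :=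
  [set p | exists2 s : seq (B * B * B), (forall t, t \in s -> R t.1.2) &
     p = \sum_(t <- s) t.1.1 * t.1.2 * t.2].

(* x is a basis of A_1, which identifies the free algebra on A_1 with
   free_alg n and A_1^{(x) m} with the span of the words of length m. *)
Definition homogeneous_alg (m : nat) (A : gradedAlg) : Prop :=
  connected A /\
  exists (n : nat) (x : 'I_n -> A),
    [/\ forall i, homog A 1 (x i),
        forall a, homog A 1 a ->
          exists! c : {ffun 'I_n -> k}, a = \sum_(i < n) c i *: x i,
        forall a, exists p, free_eval x p = a &
        exists2 R : set (free_alg n),
          forall r, R r -> forall w, w \in msupp r -> size w = m &
          forall p, free_eval x p = 0 <-> two_sided_ideal R p].

Record twisting_system (A : gradedAlg) := TwistingSystem {
  twist :> int -> {linear A -> A};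
  twist_bij : forall i, bijective (twist i);
  twist_homog : forall i j a, homog A j a -> homog A j (twist i a);
  twistM : forall i j l a b, homog A j a -> homog A l b ->
    twist i (a * twist j b) = twist i a * twist (i + j) b;
  twist1 : forall i, twist i 1 = 1;
  twist0 : forall a, twist 0 a = a
}.

Record coaction (A : gradedAlg) (K : hopfAlg k) := Coaction {
  coact :> {lrmorphism A -> tensor A K};
  coactA : forall a,
    tassoc (tmap coact idfun (coact a)) = tmap idfun (comul K) (coact a);
  coact_counit : forall a,
    tsum (fun a0 a1 => (counit K a1 : k) *: a0) (coact a) = a;
  coact_homog : forall i a, homog A i a ->
    exists2 s : seq (A * K), (forall p, p \in s -> homog A i p.1) &
      coact a = \sum_(p <- s) p.1 ⊗ p.2
}.

(* (H, rho) is the right universal quantum group of A, i.e. the initial Hopf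
   algebra right coacting on A preserving the grading. *)
Definition is_universal (A : gradedAlg) (H : hopfAlg k) (rho : coaction A H) :
    Prop :=
  forall (K : hopfAlg k) (rho' : coaction A K),
    exists f : {lrmorphism H -> K},
      [/\ is_hopf_morphism f,
          forall a, tmap idfun f (rho a) = rho' a &
          forall g : {lrmorphism H -> K}, is_hopf_morphism g ->
            (forall a, tmap idfun g (rho a) = rho' a) -> g =1 f].

End Graded.

Arguments homog {k} A i.

Section GradedTheory.
Variables (k : fieldType) (A : gradedAlg k).
Local Notation h := (homog A).

Definition gsupp (a : A) : {fset int} := fset_set [set i | gcomp A i a != 0].

Lemma gsuppP (a : A) (i : int) : i \notin gsupp a -> gcomp A i a = 0.
Proof.
rewrite /gsupp in_fset_set; last exact: gcomp_fin.
by move=> /negP H; apply/eqP/negPn/negP => ai; exact: (H (mem_set _)).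
Qed.

Lemma homog_gcomp i (a : A) : h i (gcomp A i a).
Proof. by rewrite /homog /= gcomp_id eqxx. Qed.

Lemma homogE i j (a : A) : h i a -> gcomp A j a = if j == i then a else 0.
Proof. by rewrite /homog /= => ha; rewrite -{1}ha gcomp_id ha. Qed.

Lemma homog_lin i (c : k) (a b : A) : h i a -> h i b -> h i (c *: a + b).
Proof. by rewrite /homog /= linearP => -> ->. Qed.

Lemma homog0 i : h i (0 : A). Proof. by rewrite /homog /= linear0. Qed.

Lemma homogZ i c (a : A) : h i a -> h i (c *: a).
Proof. by rewrite /homog /= linearZ_LR => ->. Qed.

Lemma homog_sum i (I : Type) (r : seq I) (P : pred I) (F : I -> A) :
  (forall j, P j -> h i (F j)) -> h i (\sum_(j <- r | P j) F j).
Proof.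
move=> hF; apply: big_ind => //; first exact: homog0.
by move=> a b ha hb; rewrite -[a]scale1r; apply: homog_lin.
Qed.

Lemma gcomp_sumE (a : A) : a = \sum_(i <- gsupp a) gcomp A i a.
Proof.
by rewrite -[LHS]gcomp_sum (fsbigTE (gsupp a))//; exact: gsuppP.
Qed.

Lemma homog_eq (W : lmodType k) (f g : A -> W) : linear f -> linear g ->
  (forall i a, h i a -> f a = g a) -> f =1 g.
Proof.
move=> lf lg fg a.
pose f' : {linear A -> W} := HB.pack f (GRing.isLinear.Build k A W *:%R f lf).
pose g' : {linear A -> W} := HB.pack g (GRing.isLinear.Build k A W *:%R g lg).
rewrite -[f a]/(f' a) -[g a]/(g' a) [a]gcomp_sumE !linear_sum.
by apply: eq_bigr => i _; apply: (fg i); apply: homog_gcomp.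
Qed.

End GradedTheory.

Section ZhangTwist.
Variables (k : fieldType) (A : gradedAlg k) (tau : twisting_system A).
Local Notation h := (homog A).

(* the bilinear product with a . b = a tau_j(b) for a of degree j *)
Definition zhang_mul (a b : A) : A :=
  \sum_(i \in [set: int]) gcomp A i a * tau i b.

Fact zhang_mulE (s : {fset int}) a b : (gsupp a `<=` s)%fset ->
  zhang_mul a b = \sum_(i <- s) gcomp A i a * tau i b.
Proof.
move=> /fsubsetP as_; apply: fsbigTE => i is_.
by rewrite gsuppP ?mul0r//; apply: contra is_ => /as_.
Qed.

Lemma zhang_mul_homog i a b : h i a -> zhang_mul a b = a * tau i b.
Proof.
move=> ha; rewrite /zhang_mul (fsbigTE [fset i]%fset); last first.
  by move=> j; rewrite inE (homogE _ ha) => /negbTE ->; rewrite mul0r.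
by rewrite big_seq_fset1 ha.
Qed.

Fact zhang_linl b : linear (zhang_mul^~ b).
Proof.
move=> c x y.
pose s := (gsupp x `|` gsupp y `|` gsupp (c *: x + y))%fset.
rewrite !(@zhang_mulE s); first last.
- exact: fsubsetUr.
- by rewrite /s -fsetUA fsubsetUl.
- by rewrite /s -fsetUA fsetUCA fsubsetUl.
rewrite scaler_sumr -big_split; apply: eq_bigr => i _ /=.
by rewrite linearP mulrDl scalerAl.
Qed.

Fact zhang_linr a : linear (zhang_mul a).
Proof.
move=> c x y; rewrite !(zhang_mulE _ (fsubset_refl _)).
rewrite scaler_sumr -big_split; apply: eq_bigr => i _ /=.
by rewrite linearP mulrDr scalerAr.
Qed.

Fact twistM_homog i j a b : h j a ->
  tau i (a * tau j b) = tau i a * tau (i + j) b.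
Proof.
move=> ha; move: b; apply: homog_eq.
- by move=> c x y; rewrite linearP mulrDr -scalerAr linearP.
- by move=> c x y; rewrite linearP mulrDr -scalerAr.
- by move=> l b hb; apply: twistM hb.
Qed.

Lemma zhang_homog i j a b : h i a -> h j b -> h (i + j) (zhang_mul a b).
Proof.
move=> ha hb; rewrite (zhang_mul_homog _ ha).
by apply: gcomp_mul => //; apply: twist_homog.
Qed.

Definition zhang : Type := A.
HB.instance Definition _ := GRing.Lmodule.copy zhang A.

Fact zhangA : associative zhang_mul.
Proof.
have ll := zhang_linl; have lr := zhang_linr.
move=> x y z; move: x; apply: homog_eq.
- exact: ll.
- by move=> c u v; rewrite !ll.
move=> i a ha; move: y; apply: homog_eq.
- by move=> c u v; rewrite ll !lr.
- by move=> c u v; rewrite lr !ll.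
move=> j b hb; rewrite (zhang_mul_homog z hb) !(zhang_mul_homog _ ha).
rewrite (@zhang_mul_homog (i + j)) ?(twistM_homog _ _ hb) ?mulrA//.
by apply: gcomp_mul => //; apply: twist_homog.
Qed.

Fact zhang1x : left_id (1 : A) zhang_mul.
Proof.
by move=> a; rewrite (@zhang_mul_homog 0) ?twist0 ?mul1r//; apply: gcomp_one.
Qed.

Fact zhangx1 : right_id (1 : A) zhang_mul.
Proof.
apply: homog_eq; [exact: zhang_linl|exact: lin_id|].
by move=> i a ha; rewrite (zhang_mul_homog _ ha) twist1 mulr1.
Qed.

Fact zhangDl : left_distributive zhang_mul +%R.
Proof. by move=> x y z; rewrite -[x]scale1r zhang_linl !scale1r. Qed.

Fact zhangDr : right_distributive zhang_mul +%R.
Proof. by move=> z x y; rewrite -[x]scale1r zhang_linr !scale1r. Qed.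

HB.instance Definition _ := GRing.Zmodule_isNzRing.Build zhang
  zhangA zhang1x zhangx1 zhangDl zhangDr (oner_neq0 A).

Fact zhangAl (c : k) (x y : zhang) : c *: (x * y) = (c *: x : zhang) * y.
Proof. exact: (esym (@lin_Z k A A (zhang_mul^~ y) c x (zhang_linl y))). Qed.

HB.instance Definition _ := GRing.Lmodule_isLalgebra.Build k zhang zhangAl.

Fact zhangAr (c : k) (x y : zhang) : c *: (x * y) = x * (c *: y : zhang).
Proof. exact: (esym (@lin_Z k A A (zhang_mul x) c y (zhang_linr x))). Qed.

HB.instance Definition _ := GRing.Lalgebra_isAlgebra.Build k zhang zhangAr.

Definition zhang_comp (i : int) : {linear zhang -> zhang} := gcomp A i.

Definition zhang_twist : gradedAlg k :=
  @GradedAlg k zhang zhang_comp (@gcomp_id k A) (@gcomp_fin k A)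
    (@gcomp_sum k A) zhang_homog (@gcomp_one k A).

Lemma zhang_twistM (i : int) (a b : zhang_twist) :
  homog A i a -> a * b = (a : A) * tau i b.
Proof. exact: zhang_mul_homog. Qed.

End ZhangTwist.

Section CocycleTwist.
Variables (k : fieldType) (A : gradedAlg k) (H : hopfAlg k).
Variables (rho : coaction A H) (sigma : cocycle H).
Local Notation h := (homog A).
Local Notation Delta := (comul H).

(* sum of the a_0 b_0 sigma(a_1, b_1) *)
Definition cocycle_mul (a b : A) : A :=
  tsum (fun a0 a1 => tsum (fun b0 b1 =>
    (sigma (a1 ⊗ b1) : k) *: (a0 * b0)) (rho b)) (rho a).

Lemma tsum_coactA (W : lmodType k) (G : A -> H -> H -> W) a :
  (forall y z, linear (fun x => G x y z)) ->
  (forall x z, linear (fun y => G x y z)) ->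
  (forall x y, linear (fun z => G x y z)) ->
  tsum (fun a0 a1 => tsum (fun a00 a01 => G a00 a01 a1) (rho a0)) (rho a) =
  tsum (fun a0 a1 => tsum (fun h1 h2 => G a0 h1 h2) (Delta a1)) (rho a).
Proof.
move=> l1 l2 l3.
have b23 x : bilin (G x) by lin.
pose g t := tsum (fun x s => tsum (G x) s) t.
have bg : bilin (fun x s => tsum (G x) s) by lin.
have lg : linear g by rewrite /g; lin.
have bass : bilin (fun (t : tensor A H) (w : H) =>
    tsum (fun u v => u ⊗ (v ⊗ w)) t) by lin.
have lass : linear (@tassoc k A H H) by rewrite /tassoc; lin.
have := congr1 g (coactA rho a); rewrite /tmap.
rewrite (linear_tsum _ _ lass) !(linear_tsum _ _ lg) => E.
transitivity (tsum (fun u v => g (tassoc (rho u ⊗ idfun v))) (rho a)).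
  apply: eq_tsum => x w /=; rewrite /tassoc tsum_tens//.
  rewrite (linear_tsum _ _ lg); apply: eq_tsum => u v.
  by rewrite /g tsum_tens// tsum_tens.
rewrite E; apply: eq_tsum => x w /=.
by rewrite /g tsum_tens.
Qed.

Fact cocycle_linl b : linear (cocycle_mul^~ b).
Proof. by rewrite /cocycle_mul; lin. Qed.

Fact cocycle_linr a : linear (cocycle_mul a).
Proof. by rewrite /cocycle_mul; lin. Qed.

Fact cocycle_mulM_l x y z : cocycle_mul (x * y) z =
  tsum (fun x0 x1 => tsum (fun y0 y1 => tsum (fun z0 z1 =>
    (sigma ((x1 * y1) ⊗ z1) : k) *: (x0 * y0 * z0))
    (rho z)) (rho y)) (rho x).
Proof. by rewrite /cocycle_mul rmorphM tsumM//; lin. Qed.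

Fact cocycle_mulM_r x y z : cocycle_mul x (y * z) =
  tsum (fun x0 x1 => tsum (fun y0 y1 => tsum (fun z0 z1 =>
    (sigma (x1 ⊗ (y1 * z1)) : k) *: (x0 * (y0 * z0)))
    (rho z)) (rho y)) (rho x).
Proof.
rewrite /cocycle_mul rmorphM; apply: eq_tsum => x0 x1.
by rewrite tsumM//; lin.
Qed.

Fact tsum_scaler (U V W : lmodType k) (c : k) (F : U -> V -> W) t :
  c *: tsum F t = tsum (fun u v => c *: F u v) t.
Proof. exact: scaler_sumr. Qed.

Fact tsum_scalel (U V W : lmodType k) (F : U -> V -> k) (w : W) t :
  tsum F t *: w = tsum (fun u v => F u v *: w) t.
Proof. exact: scaler_suml. Qed.

Fact cocycle_mulA : associative cocycle_mul.
Proof.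
move=> x y z; transitivity (tsum (fun x0 x1 => tsum (fun y0 y1 =>
    tsum (fun z0 z1 => (tsum (fun y2 y3 => tsum (fun z2 z3 =>
      sigma (x1 ⊗ (y2 * z2)) * sigma (y3 ⊗ z3)) (Delta z1)) (Delta y1) : k) *:
    (x0 * (y0 * z0))) (rho z)) (rho y)) (rho x)).
  rewrite [X in cocycle_mul x X]/cocycle_mul.
  rewrite (linear_tsum _ _ (cocycle_linr x)).
  under eq_tsum => y0 y1.
    rewrite (linear_tsum _ _ (cocycle_linr x)).
    under eq_tsum => z0 z1.
      rewrite (lin_Z _ _ (cocycle_linr x)) cocycle_mulM_r tsum_scaler.
      over.
    rewrite exchange_tsum; over.
  rewrite exchange_tsum; apply: eq_tsum => x0 x1.
  under eq_tsum => y0 y1.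
    under eq_tsum => z0 z1.
      rewrite tsum_scaler; under eq_tsum do rewrite tsum_scaler.
      over.
    rewrite exchange_tsum; over.
  rewrite (@tsum_coactA A (fun y00 y01 y1 => tsum (fun z0 z1 =>
    tsum (fun z00 z01 => (sigma (y1 ⊗ z1) : k) *:
      ((sigma (x1 ⊗ (y01 * z01)) : k) *: (x0 * (y00 * z00)))) (rho z0))
      (rho z))); [|by lin..].
  apply: eq_tsum => y0 y1.
  under eq_tsum => y2 y3.
    rewrite (@tsum_coactA A (fun z00 z01 z1 => (sigma (y3 ⊗ z1) : k) *:
      ((sigma (x1 ⊗ (y2 * z01)) : k) *: (x0 * (y0 * z00))))); [|by lin..].
    over.
  rewrite exchange_tsum; apply: eq_tsum => z0 z1.
  rewrite tsum_scalel; apply: eq_tsum => y2 y3.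
  rewrite tsum_scalel; apply: eq_tsum => z2 z3.
  by rewrite scalerA mulrC.
rewrite [X in cocycle_mul X z]/cocycle_mul.
rewrite (linear_tsum _ _ (cocycle_linl z)).
under [RHS]eq_tsum => x0 x1.
  rewrite (linear_tsum _ _ (cocycle_linl z)).
  under eq_tsum => y0 y1.
    rewrite (lin_Z _ _ (cocycle_linl z)) cocycle_mulM_l tsum_scaler.
    under eq_tsum do rewrite tsum_scaler.
    over.
  rewrite exchange_tsum; over.
rewrite (@tsum_coactA A (fun x00 x01 x1 => tsum (fun y0 y1 =>
  tsum (fun y00 y01 => (sigma (x1 ⊗ y1) : k) *: tsum (fun z0 z1 =>
    (sigma ((x01 * y01) ⊗ z1) : k) *: (x00 * y00 * z0)) (rho z))
    (rho y0)) (rho y))); [|by lin..].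
apply: eq_tsum => x0 x1.
under [RHS]eq_tsum => x2 x3.
  rewrite (@tsum_coactA A (fun y00 y01 y1 => (sigma (x3 ⊗ y1) : k) *:
    tsum (fun z0 z1 =>
      (sigma ((x2 * y01) ⊗ z1) : k) *: (x0 * y00 * z0)) (rho z))); [|by lin..].
  over.
rewrite [RHS]exchange_tsum; apply: eq_tsum => y0 y1.
under [RHS]eq_tsum => x2 x3.
  under eq_tsum do rewrite tsum_scaler.
  rewrite exchange_tsum; over.
rewrite [RHS]exchange_tsum; apply: eq_tsum => z0 z1.
rewrite -cocycleP tsum_scalel; apply: eq_tsum => x2 x3.
rewrite tsum_scalel; apply: eq_tsum => y2 y3.
by rewrite scalerA mulrC mulrA.
Qed.

Fact cocycle_mul1x : left_id (1 : A) cocycle_mul.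
Proof.
move=> a; rewrite /cocycle_mul rmorph1 tsum_tens; last by lin.
rewrite -[RHS](coact_counit rho); apply: eq_tsum => a0 a1.
by rewrite cocycle1l mul1r.
Qed.

Fact cocycle_mulx1 : right_id (1 : A) cocycle_mul.
Proof.
move=> a; rewrite /cocycle_mul rmorph1 -[RHS](coact_counit rho).
apply: eq_tsum => a0 a1; rewrite tsum_tens; last by lin.
by rewrite cocycle1r mulr1.
Qed.

Fact cocycle_mulDl : left_distributive cocycle_mul +%R.
Proof. by move=> x y z; rewrite -[x]scale1r cocycle_linl !scale1r. Qed.

Fact cocycle_mulDr : right_distributive cocycle_mul +%R.
Proof. by move=> z x y; rewrite -[x]scale1r cocycle_linr !scale1r. Qed.

Fact cocycle_homog i j a b : h i a -> h j b -> h (i + j) (cocycle_mul a b).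
Proof.
move=> /(coact_homog rho)[s sh aE] /(coact_homog rho)[t th bE].
rewrite /cocycle_mul aE tsum_sum; last by lin.
rewrite big_seq; apply: homog_sum => p ps.
rewrite tsum_tens; last by lin.
rewrite bE tsum_sum; last by lin.
rewrite big_seq; apply: homog_sum => q qt.
rewrite tsum_tens; last by lin.
by apply: homogZ; apply: gcomp_mul; [exact: sh|exact: th].
Qed.

Definition cocycle_alg : Type := A.
HB.instance Definition _ := GRing.Lmodule.copy cocycle_alg A.

HB.instance Definition _ := GRing.Zmodule_isNzRing.Build cocycle_alg
  cocycle_mulA cocycle_mul1x cocycle_mulx1 cocycle_mulDl cocycle_mulDr
  (oner_neq0 A).

Fact cocycle_algAl (c : k) (x y : cocycle_alg) :
  c *: (x * y) = (c *: x : cocycle_alg) * y.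
Proof. exact: (esym (@lin_Z k A A (cocycle_mul^~ y) c x (cocycle_linl y))). Qed.

HB.instance Definition _ :=
  GRing.Lmodule_isLalgebra.Build k cocycle_alg cocycle_algAl.

Fact cocycle_algAr (c : k) (x y : cocycle_alg) :
  c *: (x * y) = x * (c *: y : cocycle_alg).
Proof. exact: (esym (@lin_Z k A A (cocycle_mul x) c y (cocycle_linr x))). Qed.

HB.instance Definition _ :=
  GRing.Lalgebra_isAlgebra.Build k cocycle_alg cocycle_algAr.

Definition cocycle_comp (i : int) : {linear cocycle_alg -> cocycle_alg} :=
  gcomp A i.

Definition cocycle_twist : gradedAlg k :=
  @GradedAlg k cocycle_alg cocycle_comp (@gcomp_id k A) (@gcomp_fin k A)
    (@gcomp_sum k A) cocycle_homog (@gcomp_one k A).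

Lemma cocycle_twistM (a b : cocycle_twist) : a * b = cocycle_mul a b.
Proof. by []. Qed.

End CocycleTwist.

(* Main.v *)
Require Import Defs.
From HB Require Import structures.
From mathcomp Require Import all_boot all_algebra.
From mathcomp Require Import boolp classical_sets functions.
From mathcomp Require Import finmap monalg.

(* It suffices to find one Hopf algebra K coacting on A and a 2-cocycle on K
   whose twist is A^tau: universality provides a Hopf map from aut^r(A) to K along
   which the cocycle is pulled back.

   Let G be the group of the families g = (g_l), l in Z, of graded linear
   bijections of A with g_l(ab) = g_l(a) g_(l+i)(b) for a of degree i, on which
   Z acts by shifting the index, and let g act on A by g_0. Then K is the smash
   product O(G) # k[Z], where O(G) consists of the matrix coefficients of the
   finite-dimensional representations of G. An element a of degree n with
   g.a = sum_i f_i(g) a_i for all g is coacted to sum_i a_i (x) f_i t^n; since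
   (f t^n)(f' t^m) = f (f' o shift_n) t^(n+m), the law g.(ab) = (g.a)
   ((shift_n g).b) makes this multiplicative, although no single g acts by
   algebra automorphisms. All that is used of the presentation of A is that A is
   generated by a finite-dimensional A_1.

   The twisting system gives the elements gamma_n = (tau_(n+l) tau_l^-1)_l of G,
   which satisfy gamma_(n+m) = (shift_m gamma_n) gamma_m; this is exactly the
   2-cocycle condition for sigma(f t^n, f' t^m) = f(1) f'(gamma_n), and
   a ._sigma b = a (gamma_n . b) = a tau_n(b) for a of degree n. *)

Set Implicit Arguments.
Unset Strict Implicit.
Unset Printing Implicit Defensive.

Import GRing.Theory.
Local Open Scope ring_scope.

(** * Linear maps on tensor products *)

Section TensorRules.
Variable k : fieldType.
Implicit Types U V : lmodType k.

Lemma linear_morphD U V (f : U -> V) :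
  linear f -> {morph f : x y / x + y}.
Proof. by move=> lf x y; rewrite -[x]scale1r lf !scale1r. Qed.

Lemma linear_eq0 U V (f : U -> V) : linear f -> f 0 = 0.
Proof. by move=> lf; rewrite -(scale0r 0) lin_Z// scale0r. Qed.

Lemma linear_morph_sum U V (f : U -> V) I (r : seq I) (x : I -> U) :
  linear f -> f (\sum_(i <- r) x i) = \sum_(i <- r) f (x i).
Proof.
move=> lf; elim/big_rec2: _ => [|i y z _ <-]; first exact: linear_eq0.
exact: linear_morphD.
Qed.

Lemma tensDl U V (u u' : U) (v : V) : (u + u') ⊗ v = u ⊗ v + u' ⊗ v.
Proof. exact: linear_morphD ((tens_bilin U V).1 v) _ _. Qed.

Lemma tensDr U V (u : U) (v v' : V) : u ⊗ (v + v') = u ⊗ v + u ⊗ v'.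
Proof. exact: linear_morphD ((tens_bilin U V).2 u) _ _. Qed.

Lemma tensZl U V c (u : U) (v : V) : (c *: u) ⊗ v = c *: (u ⊗ v).
Proof. exact: (lin_Z c u ((tens_bilin U V).1 v)). Qed.

Lemma tensZr U V c (u : U) (v : V) : u ⊗ (c *: v) = c *: (u ⊗ v).
Proof. exact: (lin_Z c v ((tens_bilin U V).2 u)). Qed.

Lemma tens0r U V (u : U) : u ⊗ (0 : V) = 0.
Proof. exact: (linear_eq0 ((tens_bilin U V).2 u)). Qed.

End TensorRules.

Section TensorMaps.
Variable k : fieldType.
Implicit Types U V W : lmodType k.

Lemma tmap_bilin U U' V V' (f : U -> U') (g : V -> V') :
  linear f -> linear g -> bilin (fun u v => f u ⊗ g v).
Proof. by move=> lf lg; lin. Qed.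

Lemma tmap_linear U U' V V' (f : U -> U') (g : V -> V') :
  linear f -> linear g -> linear (tmap f g).
Proof. by move=> lf lg; apply/tsum_is_linear/tmap_bilin. Qed.

Lemma tmap_tens U U' V V' (f : U -> U') (g : V -> V') u v :
  linear f -> linear g -> tmap f g (u ⊗ v) = f u ⊗ g v.
Proof. by move=> lf lg; apply/tsum_tens/tmap_bilin. Qed.

Lemma tassoc_linear U V W : linear (@tassoc k U V W).
Proof.
have b : bilin (fun (t : tensor U V) (w : W) =>
    tsum (fun u v => u ⊗ (v ⊗ w)) t) by lin.
exact: tsum_is_linear.
Qed.

Lemma tassoc_tens U V W (u : U) (v : V) (w : W) :
  tassoc (u ⊗ v ⊗ w) = u ⊗ (v ⊗ w).
Proof.
have b : bilin (fun (t : tensor U V) (w : W) =>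
    tsum (fun u v => u ⊗ (v ⊗ w)) t) by lin.
have b' : bilin (fun (u : U) (v : V) => u ⊗ (v ⊗ w)) by lin.
by rewrite /tassoc tsum_tens// tsum_tens.
Qed.

End TensorMaps.

(** * Separating families of linear forms *)

Section Separation.
Variable k : fieldType.
Implicit Types U V : lmodType k.

Definition separating V (X : Type) (phi : X -> V -> k^o) :=
  forall v, (forall x, phi x v = 0) -> v = 0.

Lemma separating_eq V X (phi : X -> V -> k^o) v v' :
  (forall x, linear (phi x)) -> separating phi ->
  (forall x, phi x v = phi x v') -> v = v'.
Proof.
move=> lphi sphi vv'; apply/eqP; rewrite -subr_eq0; apply/eqP/sphi => x.
rewrite addrC -scaleN1r lphi vv' -[_ *: _]/(-1 * _ : k).
by rewrite mulN1r addNr.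
Qed.

(** Induction on the number of terms of a sum representing [t]. If every form kills the first
    right-hand factor, that term is 0; otherwise a form that does not kill it expresses the first
    left-hand factor through the others. No basis has to be chosen, and [V] may be
    infinite-dimensional. *)
Lemma separating_tensor U V X (phi : X -> V -> k^o) (t : tensor U V) :
  (forall x, linear (phi x)) -> separating phi ->
  (forall x, tsum (fun u v => (phi x v : k) *: u) t = 0) -> t = 0.
Proof.
move=> lphi sphi.
have bphi x : bilin (fun (u : U) v => (phi x v : k) *: u).
  by lin.
have evE x (s : seq (U * V)) :
    tsum (fun u v => (phi x v : k) *: u) (\sum_(p <- s) p.1 ⊗ p.2) =
    \sum_(p <- s) (phi x p.2 : k) *: p.1.
  by rewrite tsum_sum//; apply: eq_bigr => p _; rewrite tsum_tens.
rewrite (tensor_sum t) /(tsum (@tens _ _ _)); move: (repr t) => {t} s.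
have [n] := ubnP (size s); elim: n s => // n IHn [|[u v] s]; rewrite ?big_nil//.
rewrite big_cons /= ltnS => sn ev0.
have ev x : (phi x v : k) *: u + \sum_(p <- s) (phi x p.2 : k) *: p.1 = 0.
  by rewrite -[RHS](ev0 x) tsumD// tsum_tens// evE.
have [v0|/existsNP[x /eqP c0]] := pselect (forall x, phi x v = 0).
  have uv0 : u ⊗ v = 0 by rewrite (sphi v v0) tens0r.
  by rewrite uv0 add0r in ev0 *; exact: IHn.
set c : k := phi x v in c0.
have uE : u = \sum_(p <- s) (- (phi x p.2 / c)) *: p.1.
  have /eqP := ev x; rewrite addr_eq0 => /eqP /(congr1 ( *:%R c^-1)).
  rewrite scalerA mulVf// scale1r => ->; rewrite -sumrN scaler_sumr.
  by apply: eq_bigr => p _; rewrite -scaleNr scalerA mulrN mulrC.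
(* uE eliminates u from the sum of the p.1 (x) p.2 and leaves one term less. *)
pose s' := [seq (p.1, p.2 - (phi x p.2 / c) *: v) | p <- s].
have tE : u ⊗ v + \sum_(p <- s) p.1 ⊗ p.2 = \sum_(p <- s') p.1 ⊗ p.2.
  rewrite big_map /= {1}uE (linear_morph_sum _ _ ((tens_bilin U V).1 v)).
  rewrite -big_split /=.
  by apply: eq_bigr => p _;
    rewrite tensDr -[- (_ *: v)]scaleNr tensZr tensZl addrC.
by rewrite tE; apply: IHn; rewrite ?size_map// => y; rewrite -tE.
Qed.

(** One factor is treated at a time: the slice of [t] by [psi y] is a vector of [U], and every
    [phi x] kills it. *)
Lemma separating_tens U V X Y (phi : X -> U -> k^o) (psi : Y -> V -> k^o) :
  (forall x, linear (phi x)) -> (forall y, linear (psi y)) ->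
  separating phi -> separating psi ->
  separating (fun p : X * Y =>
    tsum (fun u v => phi p.1 u * psi p.2 v : k^o)).
Proof.
move=> lphi lpsi sphi spsi t t0.
apply: (separating_tensor lpsi spsi) => y; apply: sphi => x.
rewrite -[RHS](t0 (x, y)) (linear_tsum _ _ (lphi x)); apply: eq_tsum => u v /=.
by rewrite (lin_Z _ _ (lphi x)) mulrC.
Qed.

End Separation.

(** * Representative functions *)

Section Representative.
Variables (k : fieldType) (G : groupType).

(** Rows and columns are indexed by an arbitrary finite type, so that direct sums and tensor
    products of representations live on [I + J] and [I * J] without reindexing. *)
Definition mx_rep (I : finType) (M : G -> I -> I -> k) :=
  (forall i j, M 1%g i j = (i == j)%:R) /\
  (forall x y i j, M (x * y)%g i j = \sum_l M x i l * M y l j).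

Definition representative (f : G -> k) :=
  exists (I : finType) (M : G -> I -> I -> k) (u v : I -> k),
    mx_rep M /\ forall g, f g = \sum_i \sum_j u i * M g i j * v j.

Lemma mx_rep_coef (I : finType) (M : G -> I -> I -> k) i j :
  mx_rep M -> representative (fun g => M g i j).
Proof.
move=> rM; exists I, M, (fun l => (l == i)%:R), (fun l => (l == j)%:R).
split=> // g; rewrite (bigD1 i)//= [X in _ + X]big1 => [|l /negbTE ->];
  last first.
  by rewrite big1// => p _; rewrite !mul0r.
rewrite (bigD1 j)//= big1 => [|p /negbTE ->]; last by rewrite mulr0.
by rewrite !eqxx mul1r mulr1 !addr0.
Qed.

Lemma mx_rep_tens (I J : finType) M N :
  @mx_rep I M -> @mx_rep J N ->
  mx_rep (fun g (p q : I * J) => M g p.1 q.1 * N g p.2 q.2).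
Proof.
move=> [M1 MM] [N1 NM]; split=> [[i j] [i' j']|x y [i j] [i' j']] /=.
  by rewrite M1 N1 xpair_eqE -natrM mulnb.
rewrite MM NM big_distrlr/= pair_bigA /=; apply: eq_bigr => p _.
by rewrite mulrACA.
Qed.

(** This is the contragredient representation: inversion and transposition both reverse products. *)
Lemma mx_rep_dual (I : finType) M :
  @mx_rep I M -> mx_rep (fun g i j => M g^-1%g j i).
Proof.
move=> [M1 MM]; split=> [i j|x y i j]; first by rewrite invg1 M1 eq_sym.
by rewrite invgM MM; apply: eq_bigr => l _; rewrite mulrC.
Qed.

(** The combination is a coefficient of the direct sum of the two representations; the scalar [c] is
    absorbed into the row vector. *)
Lemma representative_lin (c : k) f g : representative f -> representative g ->
  representative (fun x => c * f x + g x).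
Proof.
move=> [I [M [u [v [[M1 MM] fE]]]]] [J [N [u' [v' [[N1 NM] gE]]]]].
pose P g (p q : I + J) := match p, q with
  | inl i, inl i' => M g i i' | inr j, inr j' => N g j j' | _, _ => 0 end.
exists (I + J)%type, P,
  (fun p => match p with inl i => c * u i | inr j => u' j end),
  (fun p => match p with inl i => v i | inr j => v' j end).
split; first split=> [[i|j] [i'|j']|x y [i|j] [i'|j']] //=.
- by rewrite big_sumType /= MM [X in _ + X]big1 ?addr0// => l _; rewrite mulr0.
- rewrite big_sumType /= !big1 ?addr0// => l _;
  [by rewrite mul0r|by rewrite mulr0].
- rewrite big_sumType /= !big1 ?addr0// => l _;
  [by rewrite mulr0|by rewrite mul0r].
- by rewrite big_sumType /= NM [X in X + _]big1 ?add0r// => l _; rewrite mulr0.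
move=> x; rewrite fE gE big_sumType /= mulr_sumr; congr (_ + _).
  apply: eq_bigr => i _; rewrite big_sumType /= mulr_sumr.
  rewrite [X in _ = _ + X]big1 ?addr0; last by move=> l _; rewrite mulr0 mul0r.
  by apply: eq_bigr => l _; rewrite !mulrA.
apply: eq_bigr => i _; rewrite big_sumType /= [X in _ = X + _]big1 ?add0r//.
by move=> l _; rewrite mulr0 mul0r.
Qed.

Lemma representative_mul f g : representative f -> representative g ->
  representative (fun x => f x * g x).
Proof.
move=> [I [M [u [v [rM fE]]]]] [J [N [u' [v' [rN gE]]]]].
exists (I * J)%type, (fun g p q => M g p.1 q.1 * N g p.2 q.2),
  (fun p => u p.1 * u' p.2), (fun p => v p.1 * v' p.2).
split=> [|x]; first exact: mx_rep_tens.
rewrite fE gE big_distrlr /= pair_bigA /=; apply: eq_bigr => p _.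
rewrite big_distrlr /= pair_bigA /=; apply: eq_bigr => q _.
by rewrite mulrACA (mulrACA (u _)).
Qed.

Lemma representative_cst (c : k) : representative (fun=> c).
Proof.
exists unit, (fun _ _ _ => 1), (fun=> c), (fun=> 1); split.
  by split=> [[] []|x y [] []]//; rewrite big_const card_unit /= addr0 mul1r.
by move=> g; rewrite !big_const card_unit /= !addr0 !mulr1.
Qed.

Lemma representative_comp (s : G -> G) f :
  s 1%g = 1%g -> {morph s : x y / (x * y)%g} ->
  representative f -> representative (f \o s).
Proof.
move=> s1 sM [I [M [u [v [[M1 MM] fE]]]]].
exists I, (M \o s), u, v; split=> [|g]; last exact: fE.
by split=> [i j|x y i j] /=; rewrite ?s1 ?M1// sM MM.
Qed.

Lemma representative_inv f :
  representative f -> representative (fun g => f g^-1%g).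
Proof.
move=> [I [M [u [v [rM fE]]]]].
exists I, (fun g i j => M g^-1%g j i), v, u; split=> [|g].
  exact: mx_rep_dual.
rewrite fE exchange_big; apply: eq_bigr => i _; apply: eq_bigr => j _ /=.
by rewrite mulrC mulrA mulrAC.
Qed.

Definition is_representative : {pred G -> k^o} :=
  fun f => `[< representative f >].

Fact is_representative_submod :
  @GRing.submod_closed k (G -> k^o : lmodType k) is_representative.
Proof.
split=> [|c f g /asboolP rf /asboolP rg]; apply/asboolP.
  exact: (representative_cst 0).
exact: representative_lin.
Qed.

HB.instance Definition _ := GRing.isSubmodClosed.Build k (G -> k^o)
  is_representative is_representative_submod.

Record repfun := Repfun {
  repfun_val :> G -> k^o; _ : repfun_val \in is_representative }.

HB.instance Definition _ := [isSub for repfun_val].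
HB.instance Definition _ := [Choice of repfun by <:].
HB.instance Definition _ := [SubChoice_isSubZmodule of repfun by <:].
HB.instance Definition _ := [SubZmodule_isSubLmodule of repfun by <:].

Definition mkrepfun f (fP : representative f) : repfun := Repfun (asboolT fP).

Lemma repfunP (f : repfun) : representative f.
Proof. by apply: asboolW; case: f. Qed.

Lemma repfun_eq (f g : repfun) : (forall x, f x = g x) -> f = g.
Proof. by move=> fg; apply: val_inj; apply: funext. Qed.

Definition repfun_one : repfun := mkrepfun (representative_cst 1).

Definition repfun_mul (f g : repfun) : repfun :=
  mkrepfun (representative_mul (repfunP f) (repfunP g)).

Fact repfun_mulA : associative repfun_mul.
Proof. by move=> f g h; apply: repfun_eq => x /=; rewrite mulrA. Qed.

Fact repfun_mul1x : left_id repfun_one repfun_mul.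
Proof. by move=> f; apply: repfun_eq => x /=; rewrite mul1r. Qed.

Fact repfun_mulx1 : right_id repfun_one repfun_mul.
Proof. by move=> f; apply: repfun_eq => x /=; rewrite mulr1. Qed.

Fact repfun_mulDl : left_distributive repfun_mul +%R.
Proof. by move=> f g h; apply: repfun_eq => x /=; rewrite [LHS]mulrDl. Qed.

Fact repfun_mulDr : right_distributive repfun_mul +%R.
Proof. by move=> f g h; apply: repfun_eq => x /=; rewrite [LHS]mulrDr. Qed.

Fact repfun_one_neq0 : repfun_one != 0.
Proof.
apply/eqP => /(congr1 (fun f : repfun => f 1%g)) /eqP.
by rewrite /= oner_eq0.
Qed.

HB.instance Definition _ := GRing.Zmodule_isNzRing.Build repfun
  repfun_mulA repfun_mul1x repfun_mulx1 repfun_mulDl repfun_mulDr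
  repfun_one_neq0.

Local Notation O := repfun.

Definition mx_coef (I : finType) (M : G -> I -> I -> k) (rM : mx_rep M) i j : O
  :=
  mkrepfun (mx_rep_coef i j rM).

Lemma repfun_sumval (J : Type) (r : seq J) (F : J -> O) x :
  (\sum_(i <- r) F i) x = \sum_(i <- r) F i x.
Proof. by elim/big_rec2: _ => // i y z _ <-. Qed.

(** Representative functions are linear combinations of matrix entries, and on an entry the
    coproduct is just the formula for a matrix product. *)
Lemma repfun_ind (P : O -> Prop) :
  (forall c f g, P f -> P g -> P (c *: f + g)) ->
  (forall (I : finType) (M : G -> I -> I -> k) (rM : mx_rep M) i j,
     P (mx_coef rM i j)) ->
  forall f, P f.
Proof.
move=> Plin Pcoef f; have [I [M [u [v [rM fE]]]]] := repfunP f.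
(* Closure under [c *: f + g] alone does not give 0, so some function satisfying [P] is needed
   first: the coefficient 1 of the trivial representation, from which 0 = -1 + 1. *)
have P0 : P 0.
  have rM1 : mx_rep (fun (_ : G) (_ _ : unit) => 1 : k).
    by split=> [[] []|x y [] []]//; rewrite big_const card_unit /= addr0 mul1r.
  have := Plin (-1) _ _ (Pcoef _ _ rM1 tt tt) (Pcoef _ _ rM1 tt tt).
  by rewrite scaleN1r addNr.
have -> : f = \sum_i \sum_j (u i * v j) *: mx_coef rM i j.
  apply: repfun_eq => x; rewrite fE repfun_sumval; apply: eq_bigr => i _.
  rewrite repfun_sumval; apply: eq_bigr => j _.
  exact: mulrAC.
apply: big_ind => [|g h Pg Ph|i _]; first exact: P0.
  by rewrite -[g]scale1r; apply: Plin.
apply: big_ind => [|g h Pg Ph|j _]; first exact: P0.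
  by rewrite -[g]scale1r; apply: Plin.
by rewrite -[_ *: _]addr0; apply: Plin.
Qed.

(** The list [s] plays the role of the coproduct of [f], with p.1 and p.2 as its Sweedler
    components. *)
Definition repfun_splits (f : O) (s : seq (O * O)) :=
  forall x y, f (x * y)%g = \sum_(p <- s) p.1 x * p.2 y.

Lemma repfun_split f : exists s, repfun_splits f s.
Proof.
elim/repfun_ind: f => [c f g [s fs] [t gt]|I M rM i j].
  exists ([seq (c *: p.1, p.2) | p <- s] ++ t) => x y.
  rewrite big_cat big_map /= [LHS]/(c * f _ + g _) fs gt mulr_sumr.
  by congr (_ + _); apply: eq_bigr => p _; rewrite mulrA.
exists [seq (mx_coef rM i l, mx_coef rM l j) | l <- enum I] => x y.
by rewrite big_map big_enum /= rM.2.
Qed.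

Definition repfun_inv (f : O) : O := mkrepfun (representative_inv (repfunP f)).

End Representative.

(** * The smash product of O(G) and k[Z] *)

Record shiftGroup := ShiftGroup {
  shift_sort :> groupType;
  shift : int -> shift_sort -> shift_sort;
  shiftM : forall n x y, shift n (x * y)%g = (shift n x * shift n y)%g;
  shift0 : forall x, shift 0 x = x;
  shiftD : forall m n x, shift (m + n) x = shift n (shift m x)
}.

Section Smash.
Variables (k : fieldType) (G : shiftGroup).
Local Notation O := (repfun k G).

Lemma shift1 n : shift n (1%g : G) = 1%g.
Proof. by apply: (mulgI (shift n 1%g)); rewrite -shiftM !mulg1. Qed.

Lemma shiftK n (x : G) : shift (- n) (shift n x) = x.
Proof. by rewrite -shiftD subrr shift0. Qed.

Definition repfun_shift n (f : O) : O :=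
  mkrepfun (representative_comp (shift1 n) (shiftM n) (repfunP f)).

(* finitely supported families (f_n), standing for the sum of the f_n t^n *)
Definition smash : Type := {malg O[int]}.
HB.instance Definition _ := GRing.Zmodule.on smash.

Definition smono (n : int) (f : O) : smash := << f *g n >>.

(** The scalars lie in [k] and act on each coefficient function, unlike those of the coefficient
    ring [O]. *)
Let smscale (c : k) (F : smash) : smash :=
  [malg n in msupp F => c *: F@_n].

Let smscaleE c F n : (smscale c F)@_n = c *: F@_n.
Proof.
by rewrite mcoeffE; case: msuppP => // _; rewrite scaler0.
Qed.

Fact smscaleA a b F : smscale a (smscale b F) = smscale (a * b) F.
Proof. by apply/malgP => n; rewrite !smscaleE scalerA. Qed.
Fact smscale1 : left_id 1 smscale.
Proof. by move=> F; apply/malgP => n; rewrite smscaleE scale1r. Qed.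
Fact smscaleDr : right_distributive smscale +%R.
Proof.
by move=> a F F'; apply/malgP => n; rewrite mcoeffD !smscaleE mcoeffD scalerDr.
Qed.
Fact smscaleDl F : {morph smscale^~ F : a b / a + b}.
Proof.
by move=> a b; apply/malgP => n; rewrite mcoeffD !smscaleE scalerDl.
Qed.

HB.instance Definition _ := GRing.Zmodule_isLmodule.Build k smash
  smscaleA smscale1 smscaleDr smscaleDl.

Lemma smash_coef_lin c (F F' : smash) n :
  (c *: F + F')@_n = c *: F@_n + F'@_n.
Proof. by rewrite mcoeffD smscaleE. Qed.

Lemma smono_linear n : linear (smono n).
Proof.
move=> c f g; apply/malgP => m; rewrite smash_coef_lin !mcoeffU.
by rewrite mulrnDl scalerMnr.
Qed.

Section Ext.
Variable W : lmodType k.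
Implicit Type phi : int -> O -> W.

(** The map on the direct sum of the O t^n induced by maps [phi n] on the summands. *)
Definition smash_ext phi (F : smash) : W := \sum_(n <- msupp F) phi n F@_n.

(** Linear maps kill the zero coefficients, so the support may be enlarged. This allows a common
    index set for summands whose supports differ. *)
Let smash_extEw phi (d : {fset int}) F : (forall n, linear (phi n)) ->
  (msupp F `<=` d)%fset -> smash_ext phi F = \sum_(n <- d) phi n F@_n.
Proof.
move=> lphi Fd;
  rewrite /smash_ext (big_fset_incl _ Fd)// => n _ /mcoeff_outdom ->.
exact: linear_eq0.
Qed.

Lemma smash_ext_linear phi :
  (forall n, linear (phi n)) -> linear (smash_ext phi).
Proof.
move=> lphi c F F'.
pose d := (msupp F `|` msupp F' `|` msupp (c *: F + F'))%fset.
have d1 : (msupp F `<=` d)%fset by rewrite /d -fsetUA fsubsetUl.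
have d2 : (msupp F' `<=` d)%fset by rewrite /d -fsetUA fsetUCA fsubsetUl.
have d3 : (msupp (c *: F + F') `<=` d)%fset by exact: fsubsetUr.
rewrite !(@smash_extEw _ d)//.
rewrite scaler_sumr -big_split; apply: eq_bigr => n _ /=.
by rewrite smash_coef_lin lphi.
Qed.

Lemma smash_extU phi n f :
  (forall n, linear (phi n)) -> smash_ext phi (smono n f) = phi n f.
Proof.
move=> lphi; rewrite (@smash_extEw _ [fset n]%fset)// ?msuppU_le//.
by rewrite big_seq_fset1 mcoeffUU.
Qed.

End Ext.

Lemma smashE (F : smash) : F = smash_ext smono F.
Proof. exact: monalgE. Qed.

Lemma smash_eq (W : lmodType k) (f g : smash -> W) : linear f -> linear g ->
  (forall n x, f (smono n x) = g (smono n x)) -> f =1 g.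
Proof.
move=> lf lg fg F; rewrite [F]smashE /smash_ext !linear_morph_sum//.
by apply: eq_bigr => n _; apply: fg.
Qed.

Definition smash_mul (F F' : smash) : smash :=
  smash_ext (fun n (f : O) =>
    smash_ext (fun m (f' : O) => smono (n + m) (f * repfun_shift n f')) F') F.

Let mul_linl n m f' : linear (fun f : O => smono (n + m) (f * repfun_shift n
  f')).
Proof.
move=> c f g; rewrite -smono_linear; congr smono; apply: repfun_eq => x.
rewrite -[LHS]/((c * f x + g x) * f' (shift n x)).
by rewrite mulrDl -mulrA.
Qed.

Let mul_linr n m f : linear (fun f' : O => smono (n + m) (f * repfun_shift n
  f')).
Proof.
move=> c f' g'; rewrite -smono_linear; congr smono; apply: repfun_eq => x.
rewrite -[LHS]/(f x * (c * f' (shift n x) + g' (shift n x))).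
by rewrite mulrDr mulrCA.
Qed.

Let mul_linl' n F' : linear (fun f : O =>
  smash_ext (fun m (f' : O) => smono (n + m) (f * repfun_shift n f')) F').
Proof. by apply: lin_sum => m; apply: mul_linl. Qed.

Lemma smash_mul_linl F' : linear (smash_mul^~ F').
Proof. by apply: smash_ext_linear => n; apply: mul_linl'. Qed.

Lemma smash_mul_linr F : linear (smash_mul F).
Proof. by apply: lin_sum => n; apply: smash_ext_linear => m;
  apply: mul_linr. Qed.

Lemma smash_mulU n f m g :
  smash_mul (smono n f) (smono m g) = smono (n + m) (f * repfun_shift n g).
Proof.
rewrite /smash_mul smash_extU => [|p]; last exact: mul_linl'.
by rewrite smash_extU => [|p]; last exact: mul_linr.
Qed.

(** On monomials both sides are f (g o shift_n) (h o shift_(n+m)) t^(n+m+p), because the shifts form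
    an action of Z. *)
Fact smash_mulA : associative smash_mul.
Proof.
have ll := smash_mul_linl; have lr := smash_mul_linr.
move=> x y z; move: x; apply: smash_eq; first exact: ll.
  by move=> c u v; rewrite !ll.
move=> n f; move: y; apply: smash_eq; first by move=> c u v; rewrite ll !lr.
  by move=> c u v; rewrite lr !ll.
move=> m g; move: z; apply: smash_eq; first by move=> c u v; rewrite !lr.
  exact: lr.
move=> p h; rewrite !smash_mulU addrA; congr smono; apply: repfun_eq => x /=.
by rewrite mulrA -shiftD.
Qed.

Definition smash_one : smash := smono 0 1.

Fact smash_mul1x : left_id smash_one smash_mul.
Proof.
apply: smash_eq; [exact: smash_mul_linr|exact: lin_id|] => n f.
rewrite smash_mulU add0r mul1r; congr smono; apply: repfun_eq => x /=.
by rewrite shift0.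
Qed.

Fact smash_mulx1 : right_id smash_one smash_mul.
Proof.
apply: smash_eq; [exact: smash_mul_linl|exact: lin_id|] => n f.
rewrite smash_mulU addr0; congr smono; apply: repfun_eq => x /=.
by rewrite mulr1.
Qed.

Fact smash_mulDl : left_distributive smash_mul +%R.
Proof. by move=> x y z; apply: linear_morphD (smash_mul_linl z) _ _. Qed.

Fact smash_mulDr : right_distributive smash_mul +%R.
Proof. by move=> z x y; apply: linear_morphD (smash_mul_linr z) _ _. Qed.

Fact smash_one_neq0 : smash_one != 0.
Proof. by rewrite monalgU_eq0 oner_eq0. Qed.

HB.instance Definition _ := GRing.Zmodule_isNzRing.Build smash
  smash_mulA smash_mul1x smash_mulx1 smash_mulDl smash_mulDr smash_one_neq0.

Fact smash_scaleAl (c : k) (x y : smash) : c *: (x * y) = (c *: x) * y.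
Proof. exact/esym/(lin_Z _ _ (smash_mul_linl y)). Qed.

HB.instance Definition _ :=
  GRing.Lmodule_isLalgebra.Build k smash smash_scaleAl.

Fact smash_scaleAr (c : k) (x y : smash) : c *: (x * y) = x * (c *: y).
Proof. exact/esym/(lin_Z _ _ (smash_mul_linr x)). Qed.

HB.instance Definition _ :=
  GRing.Lalgebra_isAlgebra.Build k smash smash_scaleAr.

Lemma smonoM n f m g :
  smono n f * smono m g = smono (n + m) (f * repfun_shift n g).
Proof. exact: smash_mulU. Qed.

Lemma smono1 : 1 = smono 0 1. Proof. by []. Qed.

End Smash.

(** * The Hopf algebra structure of the smash product *)

Section SmashHopf.
Variables (k : fieldType) (G : shiftGroup).
Local Notation O := (repfun k G).
Local Notation K := (smash k G).

Lemma smash_ind (P : K -> Prop) :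
  (forall c x y, P x -> P y -> P (c *: x + y)) ->
  (forall n f, P (smono n f)) -> forall x, P x.
Proof.
move=> Plin PU F; rewrite [F]smashE.
have P0 : P 0.
  by have := Plin (-1) _ _ (PU 0 0) (PU 0 0); rewrite scaleN1r addNr.
apply: big_ind => // x y Px Py; by rewrite -[x]scale1r; apply: Plin.
Qed.

Lemma smash_coef_eq (W : lmodType k) (f g : K -> W) : linear f -> linear g ->
  (forall n (I : finType) (M : G -> I -> I -> k) (rM : mx_rep M) i j,
    f (smono n (mx_coef rM i j)) = g (smono n (mx_coef rM i j))) -> f =1 g.
Proof.
move=> lf lg fg; apply: smash_eq => // n x.
elim/repfun_ind: x => [c x y fx fy|]; last exact: fg.
by rewrite smono_linear lf lg fx fy.
Qed.

(* An element of K is a function on Z x G. Evaluations separate the elements of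
   K (x) K too, so the comultiplication can be chosen as the unique one dual to
   the partial product (n, x)(n, y) = (n, xy). *)
Definition smash_ev (p : int * G) (F : K) : k^o := F@_p.1 p.2.

Lemma smash_ev_linear p : linear (smash_ev p).
Proof. by move=> c x y; rewrite /smash_ev smash_coef_lin. Qed.

Lemma smash_evU n g m f :
  smash_ev (n, g) (smono m f) = if n == m then f g else 0.
Proof.
rewrite /smash_ev mcoeffU eq_sym; case: eqP => _ //; by rewrite mulr0n.
Qed.

Lemma smash_ev_separating : separating smash_ev.
Proof.
move=> F F0; apply/malgP => n; rewrite mcoeff0; apply: repfun_eq => x.
exact: (F0 (n, x)).
Qed.

Definition smash_ev2 (p : (int * G) * (int * G)) : tensor K K -> k^o :=
  tsum (fun u v => smash_ev p.1 u * smash_ev p.2 v).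

Lemma smash_ev2_bilin (p : (int * G) * (int * G)) :
  bilin (fun u v => smash_ev p.1 u * smash_ev p.2 v : k^o).
Proof.
have l := smash_ev_linear; split=> [v|u] c x y; rewrite l.
  by rewrite mulrDl -mulrA.
by rewrite mulrDr mulrCA.
Qed.

Lemma smash_ev2_linear p : linear (smash_ev2 p).
Proof. exact/tsum_is_linear/smash_ev2_bilin. Qed.

Lemma smash_ev2_separating : separating smash_ev2.
Proof.
by apply: separating_tens; [exact: smash_ev_linear|exact: smash_ev_linear
  |exact: smash_ev_separating|exact: smash_ev_separating].
Qed.

Definition is_smash_comul (F : K) (T : tensor K K) := forall n x m y,
  smash_ev2 ((n, x), (m, y)) T = if n == m then F@_n (x * y)%g else 0.

Let is_comul_lin c F F' T T' : is_smash_comul F T -> is_smash_comul F' T' ->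
  is_smash_comul (c *: F + F') (c *: T + T').
Proof.
move=> FT FT' n x m y; rewrite smash_ev2_linear FT FT'; case: eqP => _.
  by rewrite smash_coef_lin.
by rewrite scaler0 addr0.
Qed.

Let is_comulU n f s : repfun_splits f s ->
  is_smash_comul (smono n f) (\sum_(p <- s) smono n p.1 ⊗ smono n p.2).
Proof.
move=> fs p x q y; rewrite linear_morph_sum; last exact: smash_ev2_linear.
transitivity (\sum_(r <- s)
    if (p == n) && (q == n) then r.1 x * r.2 y else 0 : k).
  apply: eq_bigr => r _; rewrite [LHS]tsum_tens; last exact: smash_ev2_bilin.
  by rewrite !smash_evU /=; do 2!case: eqP => _; rewrite ?mulr0 ?mul0r.
rewrite -[(smono n f)@_p _]/(smash_ev (p, (x * y)%g) (smono n f)) smash_evU fs.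
case: (p =P n) => [->|_] /=; last by rewrite big1//; case: eqP.
by rewrite eq_sym; case: eqP => // _; rewrite big1.
Qed.

Let is_comul_uniq F T T' : is_smash_comul F T -> is_smash_comul F T' -> T = T'.
Proof.
move=> FT FT'; apply: (separating_eq smash_ev2_linear smash_ev2_separating).
by move=> [[n x] [m y]]; rewrite FT FT'.
Qed.

Fact smash_comul_ex F : exists T, is_smash_comul F T.
Proof.
elim/smash_ind: F => [c F F' [T FT] [T' FT']|n f].
  by exists (c *: T + T'); apply: is_comul_lin.
by have [s fs] := repfun_split f; eexists; apply: is_comulU fs.
Qed.

Definition smash_comul (F : K) : tensor K K := projT1 (cid (smash_comul_ex F)).

Lemma smash_comulP F : is_smash_comul F (smash_comul F).
Proof. by rewrite /smash_comul; case: cid. Qed.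

Lemma smash_comul_linear : linear smash_comul.
Proof.
move=> c F F'; apply: is_comul_uniq (smash_comulP _) _.
by apply: is_comul_lin; apply: smash_comulP.
Qed.

(** By uniqueness any splitting of [f] computes the coproduct; with [f] = 1 it says that t^n is
    group-like. *)
Lemma smash_comulU n f s : repfun_splits f s ->
  smash_comul (smono n f) = \sum_(p <- s) smono n p.1 ⊗ smono n p.2.
Proof. by move=> fs;
  apply: is_comul_uniq (smash_comulP _) (is_comulU n fs). Qed.

Lemma smash_comul_coef n (I : finType) (M : G -> I -> I -> k)
    (rM : mx_rep M) i j :
  smash_comul (smono n (mx_coef rM i j)) =
  \sum_l smono n (mx_coef rM i l) ⊗ smono n (mx_coef rM l j).
Proof.
rewrite (@smash_comulU _ _ [seq (mx_coef rM i l, mx_coef rM l j) | l <- enum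
  I]).
  by rewrite big_map big_enum.
by move=> x y; rewrite big_map big_enum /= rM.2.
Qed.

(** As shift_n is a group morphism, composing a splitting of [g] with it gives a splitting of g o
    shift_n. Multiplying this by a splitting of [f] gives one for the coefficient of (f t^n)(g
    t^m). *)
Fact smash_comul_monoid : monoid_morphism smash_comul.
Proof.
have lc := smash_comul_linear; split.
  rewrite smono1 (@smash_comulU _ _ [:: (1, 1)]) ?big_seq1// => x y.
  by rewrite big_seq1 /= mulr1.
move=> x y; move: x; apply: smash_eq.
- by move=> c u v; rewrite mulrDl -scalerAl lc.
- by move=> c u v; rewrite lc mulrDl -scalerAl.
move=> n f; move: y; apply: smash_eq.
- by move=> c u v; rewrite mulrDr -scalerAr lc.
- by move=> c u v; rewrite lc mulrDr -scalerAr.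
move=> m g; have [s fs] := repfun_split f; have [t gt] := repfun_split g.
rewrite smonoM (smash_comulU n fs) (smash_comulU m gt) big_distrlr /=.
rewrite (@smash_comulU _ _ [seq (p.1 * repfun_shift n q.1,
  p.2 * repfun_shift n q.2) | p <- s, q <- t]); last first.
  move=> x y; rewrite big_allpairs_dep /= fs shiftM gt big_distrlr /=.
  apply: eq_bigr => p _; apply: eq_bigr => q _; exact: mulrACA.
rewrite big_allpairs_dep; apply: eq_bigr => p _; apply: eq_bigr => q _.
by rewrite tensM !smonoM.
Qed.

HB.instance Definition _ := GRing.isLinear.Build k K (tensor K K) *:%R
  smash_comul smash_comul_linear.
HB.instance Definition _ := GRing.isMonoidMorphism.Build K (tensor K K)
  smash_comul smash_comul_monoid.

(** Evaluation at [g] with t set to 1. At the unit of G this is the counit; at the elements gamma_n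
    it provides the second argument of the cocycle. *)
Definition smash_tot (g : G) : K -> k^o := smash_ext (fun _ f => f g : k^o).

Let tot_lin (g : G) (n : int) : linear (fun f : O => f g : k^o).
Proof. by []. Qed.

Lemma smash_tot_linear g : linear (smash_tot g).
Proof. exact/smash_ext_linear/tot_lin. Qed.

Lemma smash_totU g n f : smash_tot g (smono n f) = f g.
Proof. exact/smash_extU/tot_lin. Qed.

Definition smash_counit := smash_tot 1%g.

Lemma smash_counitU n f : smash_counit (smono n f) = f 1%g.
Proof. exact: smash_totU. Qed.

Fact smash_counit_monoid : monoid_morphism smash_counit.
Proof.
have l := smash_tot_linear 1%g; split; first by rewrite smono1 [LHS]smash_totU.
move=> x y; move: x; apply: smash_eq.
- by move=> c u v; rewrite mulrDl -scalerAl [LHS]l.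
- by move=> c u v; rewrite [smash_counit _]l mulrDl -scalerAl.
move=> n f; move: y; apply: smash_eq.
- by move=> c u v; rewrite mulrDr -scalerAr [LHS]l.
- by move=> c u v; rewrite [smash_counit (_ + _)]l mulrDr -scalerAr.
by move=> m g; rewrite smonoM /smash_counit !smash_totU /= shift1.
Qed.

HB.instance Definition _ := GRing.isLinear.Build k K k^o *:%R
  smash_counit (smash_tot_linear 1%g).
HB.instance Definition _ := GRing.isMonoidMorphism.Build K k^o
  smash_counit smash_counit_monoid.

(** The antipode reverses products, so f t^n goes to t^(-n) S(f), and moving t^(-n) to the right
    composes S(f) with shift_(-n). *)
Let antipU n f : K := smono (- n) (repfun_shift (- n) (repfun_inv f)).

Definition smash_antipode : K -> K := smash_ext antipU.

Let antipU_linear n : linear (antipU n).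
Proof.
by move=> c f g; rewrite -smono_linear; congr smono; apply: repfun_eq => x.
Qed.

Fact smash_antipode_linear : linear smash_antipode.
Proof. exact/smash_ext_linear/antipU_linear. Qed.

Lemma smash_antipodeU n f :
  smash_antipode (smono n f) = smono (- n) (repfun_shift (- n) (repfun_inv f)).
Proof. exact: smash_extU. Qed.

HB.instance Definition _ := GRing.isLinear.Build k K K *:%R
  smash_antipode smash_antipode_linear.

(** On a matrix coefficient both sides are the same double sum over the two inner indices, taken in
    opposite orders. *)
Fact smash_comulA (h : K) : tassoc (tmap smash_comul idfun (smash_comul h)) =
  tmap idfun smash_comul (smash_comul h).
Proof.
have lc := smash_comul_linear; have li := @lin_id k K.
have l1 := tmap_linear lc li; have l2 := tmap_linear li lc.
move: h; apply: smash_coef_eq => [c x y|c x y|n I M rM i j].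
- by rewrite lc l1 tassoc_linear.
- by rewrite lc l2.
rewrite smash_comul_coef (linear_morph_sum _ _ l1) (linear_morph_sum _ _ l2).
rewrite (linear_morph_sum _ _ (@tassoc_linear _ _ _ _)).
transitivity (\sum_l \sum_p smono n (mx_coef rM i p) ⊗
    (smono n (mx_coef rM p l) ⊗ smono n (mx_coef rM l j))).
  apply: eq_bigr => l _; rewrite tmap_tens// smash_comul_coef.
  rewrite (linear_morph_sum _ _ ((tens_bilin _ _).1 _)).
  rewrite (linear_morph_sum _ _ (@tassoc_linear _ _ _ _)).
  by apply: eq_bigr => p _; rewrite tassoc_tens.
rewrite exchange_big; apply: eq_bigr => p _ /=.
rewrite tmap_tens// smash_comul_coef.
by rewrite (linear_morph_sum _ _ ((tens_bilin _ _).2 _)).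
Qed.

Fact smash_counitl (h : K) :
  tsum (fun h1 h2 => (smash_counit h1 : k) *: h2) (smash_comul h) = h.
Proof.
have lc := smash_comul_linear.
have b : bilin (fun h1 h2 : K => (smash_counit h1 : k) *: h2) by lin.
move: h; apply: smash_coef_eq => [c x y||n I M rM i j]; last 1 first.
- rewrite smash_comul_coef tsum_sum// (bigD1 i)//= big1 => [|l /negbTE li].
    by rewrite tsum_tens// smash_counitU /= rM.1 eqxx scale1r addr0.
  by rewrite tsum_tens// smash_counitU /= rM.1 eq_sym li scale0r.
- by rewrite lc tsum_is_linear.
- exact: lin_id.
Qed.

Fact smash_counitr (h : K) :
  tsum (fun h1 h2 => (smash_counit h2 : k) *: h1) (smash_comul h) = h.
Proof.
have lc := smash_comul_linear.
have b : bilin (fun h1 h2 : K => (smash_counit h2 : k) *: h1) by lin.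
move: h; apply: smash_coef_eq => [c x y||n I M rM i j]; last 1 first.
- rewrite smash_comul_coef tsum_sum// (bigD1 j)//= big1 => [|l /negbTE li].
    by rewrite tsum_tens// smash_counitU /= rM.1 eqxx scale1r addr0.
  by rewrite tsum_tens// smash_counitU /= rM.1 li scale0r.
- by rewrite lc tsum_is_linear.
- exact: lin_id.
Qed.

Let counit_alg_linear : linear (fun h : K => (smash_counit h : k)%:A : K).
Proof. by lin. Qed.

Fact smash_antipodel (h : K) :
  tsum (fun h1 h2 => smash_antipode h1 * h2) (smash_comul h) =
  (smash_counit h : k)%:A.
Proof.
have lc := smash_comul_linear.
have b : bilin (fun h1 h2 : K => smash_antipode h1 * h2) by lin.
move: h; apply: smash_coef_eq => [c x y||n I M rM i j].
- by rewrite lc tsum_is_linear.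
- exact: counit_alg_linear.
rewrite smash_comul_coef tsum_sum// smash_counitU /= smono1.
rewrite -(lin_Z _ _ (@smono_linear k G 0)).
transitivity (\sum_l smono 0 (repfun_shift (- n)
    (repfun_inv (mx_coef rM i l) * mx_coef rM l j))).
  apply: eq_bigr => l _.
  by rewrite tsum_tens// smash_antipodeU smonoM addNr; congr smono;
    apply: repfun_eq.
rewrite -(linear_morph_sum _ _ (@smono_linear k G 0)); congr smono.
apply: repfun_eq => x; rewrite repfun_sumval /=.
rewrite -[RHS]/(M 1%g i j * 1 : k) mulr1.
(* The sum is an entry of M(y^-1) M(y) = M(1) for y = shift_(-n) x. *)
by rewrite -(mulVg (shift (- n) x)) rM.2.
Qed.

Fact smash_antipoder (h : K) :
  tsum (fun h1 h2 => h1 * smash_antipode h2) (smash_comul h) =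
  (smash_counit h : k)%:A.
Proof.
have lc := smash_comul_linear.
have b : bilin (fun h1 h2 : K => h1 * smash_antipode h2) by lin.
move: h; apply: smash_coef_eq => [c x y||n I M rM i j].
- by rewrite lc tsum_is_linear.
- exact: counit_alg_linear.
rewrite smash_comul_coef tsum_sum// smash_counitU /= smono1.
rewrite -(lin_Z _ _ (@smono_linear k G 0)).
transitivity (\sum_l smono 0 (mx_coef rM i l * repfun_inv (mx_coef rM l j))).
  apply: eq_bigr => l _.
  rewrite tsum_tens// smash_antipodeU smonoM subrr; congr smono.
  (* Multiplying by t^n on the left shifts by n, which undoes the shift by -n in the antipode. *)
  by apply: repfun_eq => x /=; rewrite shiftK.
rewrite -(linear_morph_sum _ _ (@smono_linear k G 0)); congr smono.
apply: repfun_eq => x; rewrite repfun_sumval /=.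
rewrite -[RHS]/(M 1%g i j * 1 : k) mulr1.
by rewrite -(mulgV x) rM.2.
Qed.

Definition smash_hopf : hopfAlg k :=
  @HopfAlg k K smash_comul smash_counit smash_antipode smash_comulA
    smash_counitl smash_counitr smash_antipodel smash_antipoder.

End SmashHopf.

(** * Coactions of the smash product *)

Record twisted_action (k : fieldType) (A : gradedAlg k) (G : shiftGroup) :=
  TwistedAction {
    tact :> G -> A -> A;
    tact_linear : forall g, linear (tact g);
    tact1 : forall a, tact 1%g a = a;
    tactM : forall g h a, tact (g * h)%g a = tact g (tact h a);
    tact_homog : forall g i a, homog A i a -> homog A i (tact g a);
    tact_one : forall g, tact g 1 = 1;
    tact_mul : forall g i a b, homog A i a ->
      tact g (a * b) = tact g a * tact (shift i g) b
  }.

Definition spanning (k : fieldType) (V : lmodType k) (X : Type) (e : X -> V) :=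
  forall v, exists s : seq (k * X), v = \sum_(p <- s) p.1 *: e p.2.

Lemma free_eval_spanning (k : fieldType) (A : algType k) n (x : 'I_n -> A) :
  (forall a, exists p, free_eval x p = a) ->
  spanning (fun w : seq 'I_n => \prod_(i <- w) x i).
Proof.
move=> surj a; have [p <-] := surj a; rewrite /free_eval mmapE.
exists [seq (p@_w, w : seq 'I_n) | w : {fmonom 'I_n} <- msupp p].
by rewrite big_map; apply: eq_bigr => w _; rewrite mulr_algl.
Qed.

Lemma homog_word (k : fieldType) (A : gradedAlg k) n (x : 'I_n -> A)
    (w : seq 'I_n) : (forall i, homog A 1 (x i)) ->
  homog A (size w) (\prod_(i <- w) x i).
Proof.
move=> hx; elim: w => [|i w IHw]; first by rewrite big_nil; apply: gcomp_one.
rewrite big_cons [size _]/= -add1n PoszD.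
by apply: gcomp_mul => //; apply: hx.
Qed.

Section SmashCoaction.
Variables (k : fieldType) (A : gradedAlg k) (G : shiftGroup).
Variable act : twisted_action A G.
Local Notation O := (repfun k G).
Local Notation K := (smash k G).
Local Notation h := (homog A).

(** Such a list expresses that the orbit of [a] spans a finite-dimensional space with representative
    coordinates; the pairs in [s] are the terms of the coaction of [a] before the factor t^n is
    attached. *)
Definition act_expansion n a (s : seq (A * O)) :=
  (forall p, p \in s -> h n p.1) /\
  forall g, act g a = \sum_(p <- s) (p.2 g : k) *: p.1.

Lemma act_expansion_lin n c a b s t :
  act_expansion n a s -> act_expansion n b t ->
  act_expansion n (c *: a + b) ([seq (c *: p.1, p.2) | p <- s] ++ t).
Proof.
move=> [hs sE] [ht tE]; split=> [p|g].
  rewrite mem_cat => /orP[/mapP[q qs ->]|]; last exact: ht.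
  by apply: homogZ; apply: hs.
rewrite tact_linear sE tE big_cat big_map scaler_sumr; congr (_ + _).
by apply: eq_bigr => p _; rewrite !scalerA mulrC.
Qed.

Lemma act_expansion0 n : act_expansion n 0 [::].
Proof.
by split=> // g; rewrite big_nil; apply/linear_eq0/tact_linear.
Qed.

Lemma act_expansion1 : act_expansion 0 1 [:: (1, 1)].
Proof.
split=> [p|g]; first by rewrite inE => /eqP ->; apply: gcomp_one.
by rewrite big_seq1 tact_one scale1r.
Qed.

(** In g.(ab) the element [b] is acted on by shift_n g, so its coefficients get composed with
    shift_n, exactly as in the smash product. *)
Lemma act_expansionM n m a b s t :
  h n a -> act_expansion n a s -> act_expansion m b t ->
  act_expansion (n + m) (a * b)
    [seq (p.1 * q.1, p.2 * repfun_shift n q.2) | p <- s, q <- t].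
Proof.
move=> ha [hs sE] [ht tE]; split=> [_ /allpairsP[[p q] [/= ps qt ->]]|g].
  by apply: gcomp_mul; [apply: hs|apply: ht].
rewrite (tact_mul _ _ _ ha) sE tE big_distrlr big_allpairs_dep /=.
apply: eq_bigr => p _; apply: eq_bigr => q _.
by rewrite -scalerAl -scalerAr scalerA.
Qed.

Variables (N : nat) (x : 'I_N -> A).
Hypothesis x_homog : forall i, h 1 (x i).
Hypothesis x_gen : forall a, exists p, free_eval x p = a.
Hypothesis x_act : forall i, exists s, act_expansion 1 (x i) s.

Let gcomp_word n (w : seq 'I_N) : gcomp A n (\prod_(i <- w) x i) =
  if n == size w then \prod_(i <- w) x i else 0.
Proof. by apply: homogE; apply: homog_word. Qed.

(** Words in the generators span [A], and expansions pass from generators to words by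
    [act_expansionM]. *)
Lemma act_expansion_ex n a : h n a -> exists s, act_expansion n a s.
Proof.
move=> ha; have [s aE] := free_eval_spanning x_gen a.
(* Replacing [a] by its component of degree [n] kills the words of any other length, so each
   remaining word has the right degree. *)
rewrite -[a]ha aE linear_sum /=; elim: s {aE} => [|[c w] s [t IHs]].
  by rewrite big_nil; eexists; apply: act_expansion0.
rewrite big_cons linearZ_LR /= gcomp_word.
suff [r rE] : exists r, act_expansion n
    (if n == size w then \prod_(i <- w) x i else 0) r.
  by eexists; apply: act_expansion_lin rE IHs.
case: eqP => [->|_]; last by eexists; apply: act_expansion0.
elim: w => [|i w [r IHw]]; first by rewrite big_nil; eexists;
  exact: act_expansion1.
have [u uE] := x_act i; rewrite big_cons [size _]/= -add1n PoszD.
by eexists; apply: act_expansionM uE IHw.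
Qed.

Definition coact_ev (p : int * G) : tensor A K -> A :=
  tsum (fun u v => (smash_ev p v : k) *: u).

Let ev_bilin (p : int * G) : bilin (fun (u : A) v => (smash_ev p v : k) *: u).
Proof. by have l := smash_ev_linear p; lin. Qed.

Let ev_linear p : linear (coact_ev p).
Proof. exact/tsum_is_linear/ev_bilin. Qed.

(** The value of the coaction is characterized by its slices at the points of Z x G. They separate A
    (x) K, so it is independent of the chosen expansions, and linearity comes from uniqueness. *)
Definition is_smash_coact a T :=
  forall n g, coact_ev (n, g) T = act g (gcomp A n a).

Let is_coact_uniq a T T' : is_smash_coact a T -> is_smash_coact a T' -> T = T'.
Proof.
move=> aT aT'; apply/eqP; rewrite -subr_eq0; apply/eqP.
apply: (separating_tensor (@smash_ev_linear k G) (@smash_ev_separating k G)).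
move=> [n g]; rewrite -[LHS]/(coact_ev (n, g) _).
by rewrite addrC -scaleN1r ev_linear aT aT' scaleN1r addNr.
Qed.

Let is_coact_lin c a b T T' : is_smash_coact a T -> is_smash_coact b T' ->
  is_smash_coact (c *: a + b) (c *: T + T').
Proof. by move=> aT bT' n g; rewrite ev_linear aT bT' linearP tact_linear. Qed.

Let is_coact_expansion n a s : h n a -> act_expansion n a s ->
  is_smash_coact a (\sum_(p <- s) p.1 ⊗ smono n p.2).
Proof.
move=> ha [hs sE] m g; rewrite (linear_morph_sum _ _ (ev_linear _)).
rewrite (homogE _ ha); transitivity
    (\sum_(p <- s) if m == n then (p.2 g : k) *: p.1 else 0).
  apply: eq_bigr => p _; rewrite [LHS]tsum_tens// smash_evU.
  by case: eqP => // _; rewrite scale0r.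
case: eqP => _; first by rewrite sE.
by rewrite big1//; apply/esym/linear_eq0/tact_linear.
Qed.

Fact smash_coact_ex a : exists T, is_smash_coact a T.
Proof.
rewrite [a]gcomp_sumE; elim: (gsupp a : seq int) => [|i s [T IHs]].
  rewrite big_nil; exists 0 => n g.
  by rewrite linear0 (linear_eq0 (ev_linear _)) (linear_eq0 (tact_linear act
    g)).
have [t tE] := act_expansion_ex (homog_gcomp i a).
rewrite big_cons -[gcomp A i a]scale1r; eexists.
exact: is_coact_lin (is_coact_expansion (homog_gcomp i a) tE) IHs.
Qed.

Definition smash_coact a : tensor A K := projT1 (cid (smash_coact_ex a)).

Lemma smash_coactP a : is_smash_coact a (smash_coact a).
Proof. by rewrite /smash_coact; case: cid. Qed.

Lemma smash_coactE n a s : h n a -> act_expansion n a s ->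
  smash_coact a = \sum_(p <- s) p.1 ⊗ smono n p.2.
Proof.
by move=> ha sE;
  apply: is_coact_uniq (smash_coactP a) (is_coact_expansion ha sE).
Qed.

Lemma smash_coact_linear : linear smash_coact.
Proof.
move=> c a b; apply: is_coact_uniq (smash_coactP _) _.
by apply: is_coact_lin; apply: smash_coactP.
Qed.

Fact smash_coact_monoid : monoid_morphism smash_coact.
Proof.
have lc := smash_coact_linear; split.
  by rewrite (smash_coactE (@gcomp_one k A) act_expansion1) big_seq1.
move=> a b; move: a; apply: homog_eq.
- by move=> c u v; rewrite mulrDl -scalerAl lc.
- by move=> c u v; rewrite lc mulrDl -scalerAl.
move=> n a ha; move: b; apply: homog_eq.
- by move=> c u v; rewrite mulrDr -scalerAr lc.
- by move=> c u v; rewrite lc mulrDr -scalerAr.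
move=> m b hb; have [s sE] := act_expansion_ex ha.
have [t tE] := act_expansion_ex hb.
rewrite (smash_coactE ha sE) (smash_coactE hb tE) big_distrlr /=.
rewrite (smash_coactE (gcomp_mul ha hb) (act_expansionM ha sE tE)).
rewrite big_allpairs_dep; apply: eq_bigr => p _; apply: eq_bigr => q _.
by rewrite tensM smonoM.
Qed.

Definition smash_coact_hom : {lrmorphism A -> tensor A (smash_hopf k G)} :=
  HB.pack smash_coact
    (GRing.isLinear.Build k A (tensor A K) *:%R smash_coact smash_coact_linear)
    (GRing.isMonoidMorphism.Build A (tensor A K) smash_coact
      smash_coact_monoid).

Let ev3 (p : (int * G) * (int * G)) : tensor A (tensor K K) -> A :=
  tsum (fun u t => (smash_ev2 p t : k) *: u).

Let ev3_bilin (p : (int * G) * (int * G)) :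
  bilin (fun (u : A) t => (smash_ev2 p t : k) *: u).
Proof. by have l := @smash_ev2_linear k G p; lin. Qed.

Let ev3_linear p : linear (ev3 p).
Proof. exact/tsum_is_linear/ev3_bilin. Qed.

Let ev3_assoc p T (v : K) :
  ev3 p (tassoc (T ⊗ v)) = (smash_ev p.2 v : k) *: coact_ev p.1 T.
Proof.
have l1 : linear (fun T : tensor A K => ev3 p (tassoc (T ⊗ v))).
  by move=> c u w; rewrite tensDl tensZl tassoc_linear ev3_linear.
have l2 : linear (fun T => (smash_ev p.2 v : k) *: coact_ev p.1 T).
  by have l := ev_linear p.1; lin.
move: T; apply: tensor_eq => // u w; rewrite tassoc_tens.
rewrite [ev3 p _]tsum_tens// [coact_ev _ _]tsum_tens//.
by rewrite [smash_ev2 _ _]tsum_tens ?scalerA 1?mulrC//; apply: smash_ev2_bilin.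
Qed.

(** Both sides are compared through their slices at (i, g) and (j, g'). For [a] of degree [n] each
    slice is (g g').a when i = j = n and 0 otherwise, by the action law [tactM]. *)
Fact smash_coactA a : tassoc (tmap smash_coact idfun (smash_coact a)) =
  tmap idfun (@smash_comul k G) (smash_coact a).
Proof.
have lc := smash_coact_linear; have li := @lin_id k K.
have lD := @smash_comul_linear k G; have liA := @lin_id k A.
have l1 := tmap_linear lc li; have l2 := tmap_linear liA lD.
move: a; apply: homog_eq => [c u v|c u v|n a ha].
- by rewrite lc l1 tassoc_linear.
- by rewrite lc l2.
apply/eqP; rewrite -subr_eq0; apply/eqP.
apply: (separating_tensor (@smash_ev2_linear k G) (@smash_ev2_separating k G)).
move=> p; rewrite -[LHS]/(ev3 p _) addrC -scaleN1r ev3_linear scaleN1r.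
apply/eqP; rewrite addrC subr_eq0; apply/eqP.
have [s sE] := act_expansion_ex ha; rewrite (smash_coactE ha sE).
rewrite (linear_morph_sum _ _ l1) (linear_morph_sum _ _ l2).
rewrite (linear_morph_sum _ _ (@tassoc_linear _ _ _ _)).
rewrite !(linear_morph_sum _ _ (ev3_linear _)).
case: p => [[i g] [j g']].
transitivity (if (i == n) && (j == n) then act (g * g')%g a else 0).
  under eq_bigr do rewrite tmap_tens// ev3_assoc smash_coactP smash_evU.
  rewrite /=; case: (j =P n) => [_|_]; last first.
    by rewrite andbF big1// => p _; rewrite scale0r.
  have lg : linear (fun b => act g (gcomp A i b)).
    by move=> c u v; rewrite linearP tact_linear.
  under eq_bigr do rewrite -(lin_Z _ _ lg).
  rewrite -(linear_morph_sum _ _ lg) -sE.2 (homogE _ (tact_homog act g' ha))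
    andbT.
  by case: eqP => _; rewrite ?tactM//; apply/linear_eq0/tact_linear.
under [RHS]eq_bigr do rewrite tmap_tens// [ev3 _ _]tsum_tens// smash_comulP
  -[(smono n _)@_i _]/(smash_ev (i, (g * g')%g) (smono n _)) smash_evU.
case: (i =P n) => [->|_] /=; last first.
  by rewrite big1// => p _; rewrite if_same scale0r.
rewrite eq_sym; case: (n =P j) => [_|_]; last by rewrite big1// => p _;
  rewrite scale0r.
by rewrite sE.2.
Qed.

Fact smash_coact_counit a :
  tsum (fun a0 a1 => (smash_counit a1 : k) *: a0) (smash_coact a) = a.
Proof.
have lc := smash_coact_linear.
have b : bilin (fun (a0 : A) (a1 : K) => (smash_counit a1 : k) *: a0) by lin.
move: a; apply: homog_eq => [c u v||n a ha].
- by rewrite lc tsum_is_linear.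
- exact: lin_id.
have [s sE] := act_expansion_ex ha; rewrite (smash_coactE ha sE) tsum_sum//.
under eq_bigr do rewrite tsum_tens// smash_counitU.
by rewrite -sE.2 tact1.
Qed.

Fact smash_coact_homog i a : h i a ->
  exists2 s : seq (A * K), (forall p, p \in s -> h i p.1) &
    smash_coact a = \sum_(p <- s) p.1 ⊗ p.2.
Proof.
move=> ha; have [s sE] := act_expansion_ex ha.
exists [seq (p.1, smono i p.2) | p <- s].
  by move=> _ /mapP[p ps ->]; apply: sE.1.
by rewrite big_map; apply: smash_coactE.
Qed.

Definition smash_coaction : coaction A (smash_hopf k G) :=
  @Coaction k A (smash_hopf k G) smash_coact_hom smash_coactA
    smash_coact_counit smash_coact_homog.

End SmashCoaction.

(** * Cocycles on the smash product and their pullbacks *)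

Section SmashCocycle.
Variables (k : fieldType) (G : shiftGroup).
Local Notation O := (repfun k G).
Local Notation K := (smash k G).
Local Notation Delta := (@smash_comul k G).

Section Form.
Variable c : int -> G.

Let F (n : int) (y : K) (f : O) : k^o := f 1%g * smash_tot (c n) y.

Let F_linl n y : linear (F n y).
Proof. by move=> a f g; rewrite /F [LHS]mulrDl -mulrA. Qed.

Let F_linr n f : linear (F n ^~ f).
Proof. by move=> a y z; rewrite /F smash_tot_linear [LHS]mulrDr mulrCA. Qed.

Let P (x y : K) : k^o := smash_ext (fun n => F n y) x.

Let P_bilin : bilin P.
Proof.
split=> [y|x]; first by apply: smash_ext_linear => n; apply: F_linl.
by apply: lin_sum => n; apply: F_linr.
Qed.

(** The form (f t^n, f' t^m) -> f(1) f'(c_n) is built for an arbitrary family [c], since both the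
    cocycle and its convolution inverse have this shape. *)
Definition smash_form : tensor K K -> k^o := tsum P.

Fact smash_form_linear : linear smash_form.
Proof. exact: tsum_is_linear. Qed.

HB.instance Definition _ := GRing.isLinear.Build k (tensor K K) k^o *:%R
  smash_form smash_form_linear.

Lemma smash_formU n f m g :
  smash_form (smono n f ⊗ smono m g) = (f 1%g : k) * g (c n).
Proof.
rewrite [LHS]tsum_tens// /P smash_extU; last by move=> p; apply: F_linl.
by rewrite /F smash_totU.
Qed.

End Form.

(** Convolving the forms of [c] and [d] gives the form of their pointwise product: f(1 1) g(c_n d_n)
    splits along the two coproducts. *)
Lemma smash_convolution (c d : int -> G) (x y : K) :
  (forall n, (c n * d n)%g = 1%g) ->
  tsum (fun x1 x2 => tsum (fun y1 y2 =>
    smash_form c (x1 ⊗ y1) * smash_form d (x2 ⊗ y2)) (Delta y)) (Delta x) =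
  smash_counit x * smash_counit y :> k^o.
Proof.
move=> cd; have lD := @smash_comul_linear k G.
have l := @smash_tot_linear k G 1%g.
have b x1 x2 : bilin (fun y1 y2 =>
  smash_form c (x1 ⊗ y1) * smash_form d (x2 ⊗ y2) : k^o) by lin.
have b' z : bilin (fun x1 x2 => tsum (fun y1 y2 =>
  smash_form c (x1 ⊗ y1) * smash_form d (x2 ⊗ y2) : k^o) z) by lin.
move: x; apply: smash_eq => [a u v|a u v|n f].
- by rewrite lD tsum_is_linear.
- by rewrite [smash_counit _]l mulrDl -scalerAl.
move: y; apply: smash_eq => [||m g].
- by apply: lin_tsum_param => x1 x2 a u v; rewrite lD tsum_is_linear.
- by move=> a u v; rewrite [smash_counit (_ + _)]l mulrDr -scalerAr.
have [s fs] := repfun_split f; have [t gt] := repfun_split g.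
rewrite (smash_comulU n fs) (smash_comulU m gt) tsum_sum// !smash_counitU.
transitivity (\sum_(p <- s) \sum_(q <- t)
    (p.1 1%g * p.2 1%g) * (q.1 (c n) * q.2 (d n)) : k).
  apply: eq_bigr => p _; rewrite tsum_tens// tsum_sum//; apply: eq_bigr => q _.
  by rewrite tsum_tens// !smash_formU mulrACA.
by rewrite -[LHS]big_distrlr /= -fs -gt mulg1 cd.
Qed.

Variable gamma : int -> G.
Hypothesis gamma0 : gamma 0 = 1%g.
Hypothesis gammaD : forall m n,
  gamma (n + m) = (shift m (gamma n) * gamma m)%g.
Local Notation sigma := (smash_form gamma).

(** For x = f t^n, y = g t^m and z = h t^p both sides equal f(1) g(gamma_n) h(gamma_(n+m)). On the
    left, x y has degree n + m. On the right, h is split and evaluated at (shift_m gamma_n) gamma_m,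
    the first factor being shifted because h_1 has moved past t^m. *)
Fact smash_cocycleP (x y z : K) :
  tsum (fun x1 x2 => tsum (fun y1 y2 =>
    sigma ((x1 * y1) ⊗ z) * sigma (x2 ⊗ y2)) (Delta y)) (Delta x) =
  tsum (fun y1 y2 => tsum (fun z1 z2 =>
    sigma (x ⊗ (y1 * z1)) * sigma (y2 ⊗ z2)) (Delta z)) (Delta y) :> k^o.
Proof.
have lD := @smash_comul_linear k G.
have b x1 x2 z' : bilin (fun y1 y2 =>
  sigma ((x1 * y1) ⊗ z') * sigma (x2 ⊗ y2) : k^o) by lin.
have b' y' z' : bilin (fun x1 x2 => tsum (fun y1 y2 =>
  sigma ((x1 * y1) ⊗ z') * sigma (x2 ⊗ y2) : k^o) y') by lin.
have d x' y1 y2 : bilin (fun z1 z2 =>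
  sigma (x' ⊗ (y1 * z1)) * sigma (y2 ⊗ z2) : k^o) by lin.
have d' x' z' : bilin (fun y1 y2 => tsum (fun z1 z2 =>
  sigma (x' ⊗ (y1 * z1)) * sigma (y2 ⊗ z2) : k^o) z') by lin.
move: x; apply: smash_eq => [a u v||n f].
- by rewrite lD tsum_is_linear.
- by lin.
move: y; apply: smash_eq => [|a u v|m g].
- by apply: lin_tsum_param => x1 x2 a u v; rewrite lD tsum_is_linear.
- by rewrite lD tsum_is_linear.
move: z; apply: smash_eq => [||p h].
- by lin.
- by apply: lin_tsum_param => y1 y2 a u v; rewrite lD tsum_is_linear.
have [s fs] := repfun_split f; have [t gt] := repfun_split g.
have [r hr] := repfun_split h.
rewrite (smash_comulU n fs) (smash_comulU m gt) (smash_comulU p hr) !tsum_sum//.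
transitivity ((f 1%g : k) * g (gamma n) * h (gamma (n + m))).
  rewrite -[X in f X]mulg1 -[X in g X]mul1g fs gt big_distrlr mulr_suml.
  apply: eq_bigr => p1 _; rewrite tsum_tens// tsum_sum// mulr_suml.
  apply: eq_bigr => p2 _; rewrite tsum_tens// smonoM !smash_formU /= shift1.
  by rewrite mulrAC; congr (_ * _); rewrite mulrACA.
transitivity (\sum_(q1 <- t) \sum_(q2 <- r) (f 1%g : k) *
    ((q1.1 (gamma n) * q1.2 1%g) *
     (q2.1 (shift m (gamma n)) * q2.2 (gamma m)))).
  under [RHS]eq_bigr do rewrite -mulr_sumr.
  rewrite -mulr_sumr -[X in _ = _ * X]big_distrlr /= -gt -hr mulg1 gammaD.
  by rewrite mulrA.
apply: eq_bigr => q1 _; rewrite tsum_tens// tsum_sum//; apply: eq_bigr => q2 _.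
rewrite tsum_tens// smonoM !smash_formU -[RHS]mulrA; congr (_ * _).
exact: mulrACA.
Qed.

Fact smash_form1r (x : K) : sigma (x ⊗ 1) = smash_counit x.
Proof.
move: x; apply: smash_eq; [by lin|exact: smash_tot_linear|] => n f.
by rewrite smono1 smash_formU smash_counitU mulr1.
Qed.

Fact smash_form1l (x : K) : sigma (1 ⊗ x) = smash_counit x.
Proof.
move: x; apply: smash_eq; [by lin|exact: smash_tot_linear|] => n f.
by rewrite smono1 smash_formU smash_counitU gamma0 mul1r.
Qed.

Definition smash_cocycle : cocycle (smash_hopf k G).
Proof.
apply: (@Cocycle k (smash_hopf k G) (smash_form gamma) _ smash_cocycleP
  smash_form1r smash_form1l).
exists (smash_form (fun n => (gamma n)^-1%g)).
by split=> x y; apply: smash_convolution => n; rewrite ?mulgV ?mulVg.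
Defined.

End SmashCocycle.

(** * Pulling back cocycles along Hopf algebra maps *)

Section Pullback.
Variables (k : fieldType) (H K : hopfAlg k) (f : {lrmorphism H -> K}).
Hypothesis fP : is_hopf_morphism f.

(** In Sweedler notation, (f x)_1 (x) (f x)_2 = f(x_1) (x) f(x_2). *)
Lemma hopf_morphism_tsum (W : lmodType k) (F : K -> K -> W) x : bilin F ->
  tsum F (comul K (f x)) = tsum (fun a b => F (f a) (f b)) (comul H x).
Proof.
move=> bF; have [-> _ _] := fP; rewrite /tmap linear_tsum;
  last exact: tsum_is_linear.
by apply: eq_tsum => a b; rewrite tsum_tens.
Qed.

Lemma hopf_morphism_tsum2 (F : K -> K -> K -> K -> k^o) x y :
  (forall u v, bilin (F u v)) -> (forall u v, bilin (fun a b => F a b u v)) ->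
  tsum (fun x1 x2 => tsum (fun y1 y2 => F x1 x2 y1 y2) (comul K (f y)))
    (comul K (f x)) =
  tsum (fun x1 x2 => tsum (fun y1 y2 => F (f x1) (f x2) (f y1) (f y2))
    (comul H y)) (comul H x).
Proof.
move=> b1 b2; rewrite hopf_morphism_tsum; last first.
  by split=> [u|u]; apply: lin_tsum_param => v w;
    [apply: (b2 v w).1|apply: (b2 v w).2].
by apply: eq_tsum => a b; rewrite hopf_morphism_tsum.
Qed.

Definition pullback_form (s : tensor K K -> k^o) : tensor H H -> k^o :=
  s \o tmap f f.

Fact pullback_form_linear (s : {linear tensor K K -> k^o}) :
  linear (pullback_form s).
Proof.
by move=> c u v; rewrite /pullback_form /= tmap_linear ?linearP//; lin.
Qed.

HB.instance Definition _ (s : {linear tensor K K -> k^o}) :=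
  GRing.isLinear.Build k (tensor H H) k^o *:%R (pullback_form s)
    (pullback_form_linear s).

Lemma pullback_formE (s : {linear tensor K K -> k^o}) x y :
  pullback_form s (x ⊗ y) = s (f x ⊗ f y).
Proof. by rewrite /pullback_form /= tmap_tens//; lin. Qed.

Lemma pullback_convolution (s t : {linear tensor K K -> k^o}) :
  convolution_inverse s t ->
  convolution_inverse (pullback_form s) (pullback_form t).
Proof.
move=> st x y; have [_ fe _] := fP; rewrite -!fe -st.
rewrite (hopf_morphism_tsum2 (F := fun x1 x2 y1 y2 =>
  s (x1 ⊗ y1) * t (x2 ⊗ y2))); [|by lin|by lin].
by apply: eq_tsum => a b; apply: eq_tsum => c d; rewrite /= !pullback_formE.
Qed.

Variable sigma : cocycle K.

Definition pullback_cocycle : cocycle H.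
Proof.
apply: (@Cocycle k H (pullback_form sigma)).
- have [s' [l r]] := cocycle_invertible sigma.
  by exists (pullback_form s'); split; apply: pullback_convolution.
- move=> x y z; transitivity (tsum (fun x1 x2 => tsum (fun y1 y2 =>
      sigma ((x1 * y1) ⊗ f z) * sigma (x2 ⊗ y2))
    (comul K (f y))) (comul K (f x))).
    rewrite (hopf_morphism_tsum2 (F := fun x1 x2 y1 y2 =>
      sigma ((x1 * y1) ⊗ f z) * sigma (x2 ⊗ y2))); [|by lin|by lin].
    apply: eq_tsum => a b; apply: eq_tsum => c d.
    by rewrite /= !pullback_formE rmorphM.
  rewrite cocycleP (hopf_morphism_tsum2 (F := fun y1 y2 z1 z2 =>
    sigma (f x ⊗ (y1 * z1)) * sigma (y2 ⊗ z2))); [|by lin|by lin].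
  apply: eq_tsum => a b; apply: eq_tsum => c d.
  by rewrite /= !pullback_formE rmorphM.
- by move=> x; have [_ fe _] := fP;
  rewrite -fe /= pullback_formE rmorph1 cocycle1r.
- by move=> x; have [_ fe _] := fP;
  rewrite -fe /= pullback_formE rmorph1 cocycle1l.
Defined.

(** Since the components a_1 for [rho'] are the images under [f] of those for [rho], evaluating
    [sigma] on them is evaluating the pulled-back form on the original ones. *)
Lemma cocycle_mul_pullback (A : gradedAlg k) (rho : coaction A H)
    (rho' : coaction A K) :
  (forall a, tmap idfun f (rho a) = rho' a) ->
  cocycle_mul rho pullback_cocycle =2 cocycle_mul rho' sigma.
Proof.
move=> rhoE a b; rewrite /cocycle_mul -!rhoE.
have tE (W : lmodType k) (F : A -> K -> W) t : bilin F ->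
    tsum F (tmap idfun f t) = tsum (fun u v => F u (f v)) t.
  move=> bF; rewrite /tmap linear_tsum; last exact: tsum_is_linear.
  by apply: eq_tsum => u v; rewrite tsum_tens.
rewrite tE; last by lin.
apply: eq_tsum => u v; rewrite tE; last by lin.
by apply: eq_tsum => u' v'; rewrite -pullback_formE.
Qed.

End Pullback.

(** * Matrix coefficients in degree one *)

Section DegreeOne.
Variables (k : fieldType) (A : gradedAlg k) (G : shiftGroup).
Variable act : twisted_action A G.
Variables (N : nat) (x : 'I_N -> A).
Hypothesis x_homog : forall i, homog A 1 (x i).
Hypothesis x_basis : forall a, homog A 1 a ->
  exists! c : {ffun 'I_N -> k}, a = \sum_(i < N) c i *: x i.

Let coord_ex g j : exists c : {ffun 'I_N -> k}, act g (x j) = \sum_i c i *: x i.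
Proof.
by have [c [cE _]] := x_basis (tact_homog act g (x_homog j)); exists c.
Qed.

Let M (g : G) (i j : 'I_N) : k := projT1 (cid (coord_ex g j)) i.

Let ME g j : act g (x j) = \sum_i M g i j *: x i.
Proof. by rewrite /M; case: cid. Qed.

Let coord_uniq (c d : 'I_N -> k) :
  \sum_i c i *: x i = \sum_i d i *: x i -> c =1 d.
Proof.
move=> cd; have hc : homog A 1 (\sum_i c i *: x i).
  by apply: homog_sum => i _; apply: homogZ.
have [e [_ eP]] := x_basis hc; move=> i.
have ec : e = [ffun j => c j].
  by apply: eP; apply: eq_bigr => l _; rewrite ffunE.
have ed : e = [ffun j => d j].
  by apply: eP; rewrite cd; apply: eq_bigr => l _; rewrite ffunE.
by have := congr1 (fun e : {ffun 'I_N -> k} => e i) ed; rewrite {1}ec !ffunE.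
Qed.

(** Only the product rule of the action is twisted: G acts linearly on A_1 in the usual sense, so
    the matrices in the finite basis [x] form a representation, whose entries are the coefficients
    sought. *)
Lemma act_expansion_basis j : exists s, act_expansion act 1 (x j) s.
Proof.
have rM : mx_rep M.
  split=> [i l|g h i l].
    apply: (coord_uniq (c := M 1%g ^~ l) (d := fun i => (i == l)%:R)).
    rewrite -ME tact1 (bigD1 l)//= eqxx scale1r big1 ?addr0// => p /negbTE ->.
    by rewrite scale0r.
  apply: (coord_uniq (c := M (g * h)%g ^~ l)
    (d := fun i => \sum_p M g i p * M h p l)).
  rewrite -ME tactM ME (linear_morph_sum _ _ (tact_linear act g)).
  under [RHS]eq_bigr do rewrite scaler_suml.
  rewrite exchange_big; apply: eq_bigr => p _ /=.
  rewrite lin_Z; last exact: tact_linear.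
  by rewrite ME scaler_sumr; apply: eq_bigr => q _; rewrite scalerA mulrC.
exists [seq (x i, mx_coef rM i j) | i <- enum 'I_N]; split=> [p|g].
  by move=> /mapP[i _ ->]; apply: x_homog.
by rewrite big_map big_enum /= ME.
Qed.

End DegreeOne.

(** * The group of twisting families *)

Section TwistGroup.
Variables (k : fieldType) (A : gradedAlg k).
Local Notation h := (homog A).

(** A linear map preserving degrees commutes with the projections [gcomp], and hence so does its
    inverse. *)
Lemma graded_inverse (f g : A -> A) : linear f ->
  (forall i a, h i a -> h i (f a)) -> cancel f g -> cancel g f ->
  linear g /\ forall i a, h i a -> h i (g a).
Proof.
move=> lf hf fK gK; split=> [c a b|i a ha].
  by apply: (can_inj fK); rewrite lf !gK.
have fC b : f (gcomp A i b) = gcomp A i (f b).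
  move: b; apply: homog_eq => [c u v|c u v|j b hb];
    rewrite ?linearP ?lf ?linearP//.
  rewrite (homogE _ hb) (homogE _ (hf _ _ hb)).
  by case: eqP => // _; exact: linear_eq0.
by apply: (can_inj fK); rewrite fC gK; exact: ha.
Qed.

Local Notation family := (int -> A -> A).

(** The pair consists of a family and its inverse family, so that inversion in the group merely
    exchanges the two. *)
Definition twist_family (p : family * family) :=
  [/\ forall l, linear (p.1 l),
      forall l i a, h i a -> h i (p.1 l a),
      forall l i a b, h i a -> p.1 l (a * b) = p.1 l a * p.1 (l + i) b &
      forall l, cancel (p.1 l) (p.2 l) /\ cancel (p.2 l) (p.1 l)].

Lemma twist_family_inv p : twist_family p -> twist_family (p.2, p.1).
Proof.
move=> [lp hp mp cp].
have gi l : linear (p.2 l) /\ forall i a, h i a -> h i (p.2 l a).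
  by have [c1 c2] := cp l; apply: graded_inverse (lp l) (hp l) c1 c2.
split=> /= [l|l i a|l i a b ha|l].
- exact: (gi l).1.
- exact: (gi l).2.
- have [c1 c2] := cp l; have [c3 c4] := cp (l + i); apply: (can_inj c1).
  by rewrite (mp _ i) ?c2 ?c4//; apply: (gi l).2.
- by have [] := cp l.
Qed.

Lemma twist_family_mul p q : twist_family p -> twist_family q ->
  twist_family (fun l => p.1 l \o q.1 l, fun l => q.2 l \o p.2 l).
Proof.
move=> [lp hp mp cp] [lq hq mq cq]; split=> /= [l c a b|l i a ha|l i a b ha|l].
- by rewrite /= lq lp.
- exact/hp/hq.
- by rewrite /= (mq _ i)// (mp _ i)//; apply: hq.
- by have [c1 c2] := cp l; have [c3 c4] := cq l; split; apply: can_comp.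
Qed.

Lemma twist_family_one : twist_family (fun=> id, fun=> id).
Proof. by split. Qed.

Lemma twist_family_shift n p : twist_family p ->
  twist_family (fun l => p.1 (l + n), fun l => p.2 (l + n)).
Proof.
move=> [lp hp mp cp]; split=> //= [l i a|l i a b ha]; first exact: hp.
by rewrite (mp _ i)// addrAC.
Qed.

Record twist_group := TwistGroup {
  twist_group_val : family * family; _ : `[< twist_family twist_group_val >] }.

HB.instance Definition _ := [isSub for twist_group_val].
HB.instance Definition _ := [Choice of twist_group by <:].

Definition mk_twist p (pP : twist_family p) := TwistGroup (asboolT pP).

Lemma twist_groupP (p : twist_group) : twist_family (val p).
Proof. by apply: asboolW; case: p. Qed.

(** The inverse family is determined by the first one, so the extra data create no new elements. *)
Lemma twist_group_eq (p q : twist_group) :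
  (forall l a, (val p).1 l a = (val q).1 l a) -> p = q.
Proof.
move=> pq; apply: val_inj; have [_ _ _ cp] := twist_groupP p.
have [_ _ _ cq] := twist_groupP q; rewrite [LHS]surjective_pairing.
rewrite [RHS]surjective_pairing; congr pair; apply: funext => l;
  apply: funext => a.
  exact: pq.
have [cp1 cp2] := cp l; have [cq1 cq2] := cq l.
by apply: (can_inj cp1); rewrite cp2 pq cq2.
Qed.

Definition twist_group_mul (p q : twist_group) :=
  mk_twist (twist_family_mul (twist_groupP p) (twist_groupP q)).
Definition twist_group_inv (p : twist_group) :=
  mk_twist (twist_family_inv (twist_groupP p)).
Definition twist_group_one := mk_twist twist_family_one.

Fact twist_group_mulA : associative twist_group_mul.
Proof. by move=> p q r; apply: twist_group_eq. Qed.
Fact twist_group_mul1x : left_id twist_group_one twist_group_mul.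
Proof. by move=> p; apply: twist_group_eq. Qed.
Fact twist_group_mulx1 : right_id twist_group_one twist_group_mul.
Proof. by move=> p; apply: twist_group_eq. Qed.
Fact twist_group_mulVx :
  left_inverse twist_group_one twist_group_inv twist_group_mul.
Proof.
move=> p; apply: twist_group_eq => l a /=.
by have [_ _ _ /(_ l)[c _]] := twist_groupP p; rewrite c.
Qed.
Fact twist_group_mulxV :
  right_inverse twist_group_one twist_group_inv twist_group_mul.
Proof.
move=> p; apply: twist_group_eq => l a /=.
by have [_ _ _ /(_ l)[_ c]] := twist_groupP p; rewrite c.
Qed.

HB.instance Definition _ := isGroup.Build twist_group twist_group_mulA
  twist_group_mul1x twist_group_mulx1 twist_group_mulVx twist_group_mulxV.

Definition twist_group_shift n (p : twist_group) : twist_group :=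
  mk_twist (twist_family_shift n (twist_groupP p)).

Fact twist_group_shiftM n (p q : twist_group) :
  twist_group_shift n (p * q)%g =
  (twist_group_shift n p * twist_group_shift n q)%g.
Proof. exact: twist_group_eq. Qed.
Fact twist_group_shift0 p : twist_group_shift 0 p = p.
Proof. by apply: twist_group_eq => l a /=; rewrite addr0. Qed.
Fact twist_group_shiftD m n p :
  twist_group_shift (m + n) p = twist_group_shift n (twist_group_shift m p).
Proof. by apply: twist_group_eq => l a /=; rewrite addrA addrAC. Qed.

Definition twist_shiftGroup : shiftGroup :=
  ShiftGroup twist_group_shiftM twist_group_shift0 twist_group_shiftD.

Definition twist_act (p : twist_shiftGroup) : A -> A := (val p).1 0.

Fact twist_act_linear p : linear (twist_act p).
Proof. by have [lp _ _ _] := twist_groupP p; apply: lp. Qed.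
Fact twist_act_homog p i a : h i a -> h i (twist_act p a).
Proof. by have [_ hp _ _] := twist_groupP p; apply: hp. Qed.
(** This is the law of the family at index 0, the entry 0 of shift_i p being the entry i of p. *)
Fact twist_act_mul p i a b : h i a ->
  twist_act p (a * b) = twist_act p a * twist_act (shift i p) b.
Proof. by have [_ _ mp _] := twist_groupP p; apply: mp. Qed.
Fact twist_act_one p : twist_act p 1 = 1.
Proof.
have [_ _ mp cp] := twist_groupP p; rewrite /twist_act; have [_ c] := cp 0.
(* For u the preimage of 1, the product rule applied to 1 u gives 1 = p(1) 1. *)
have := mp 0 0 1 ((val p).2 0 1) (@gcomp_one k A).
by rewrite mul1r addr0 c mulr1 => <-.
Qed.

Definition twist_action : twisted_action A twist_shiftGroup :=
  @TwistedAction k A twist_shiftGroup twist_act twist_act_linear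
    (fun=> erefl) (fun _ _ _ => erefl) twist_act_homog twist_act_one
      twist_act_mul.

Variable tau : twisting_system A.

Let tinv_ex l : exists g, cancel (tau l) g /\ cancel g (tau l).
Proof. by have [g c1 c2] := twist_bij tau l; exists g. Qed.

Let tinv l : A -> A := projT1 (cid (tinv_ex l)).

Let tauK l : cancel (tau l) (tinv l).
Proof. by rewrite /tinv; case: cid => ? []. Qed.

Let tinvK l : cancel (tinv l) (tau l).
Proof. by rewrite /tinv; case: cid => ? []. Qed.

Let tinv_graded l : linear (tinv l) /\ forall i a, h i a -> h i (tinv l a).
Proof.
apply: graded_inverse (@tauK l) (@tinvK l); first by move=> c a b;
  rewrite linearP.
exact: twist_homog.
Qed.

(** Put a' = tau_l^-1(a) and c = tau_(l+i)^-1(b). The twisting identity gives ab = tau_l(a'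
    tau_i(c)); applying it again to tau_(n+l)(a' tau_i(c)) gives tau_(n+l)(a') tau_(n+l+i)(c). *)
Fact twisting_familyP n : twist_family
  (fun l => tau (n + l) \o tinv l, fun l => tau l \o tinv (n + l)).
Proof.
split=> /= [l c a b|l i a ha|l i a b ha|l].
- by rewrite /= (tinv_graded l).1 linearP.
- by apply: twist_homog; apply: (tinv_graded l).2.
- have ha' := (tinv_graded l).2 _ _ ha.
  rewrite addrA -(twistM_homog tau _ _ ha'); congr (tau _ _).
  by apply: (can_inj (@tauK l)); rewrite twistM_homog// !tinvK.
- by split; apply: can_comp; do ?[exact: tauK|exact: tinvK].
Qed.

Definition twisting_elt n : twist_shiftGroup := mk_twist (twisting_familyP n).

Lemma twisting_elt0 : twisting_elt 0 = 1%g.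
Proof. by apply: twist_group_eq => l a /=; rewrite add0r tinvK. Qed.

(** The product telescopes: at index l the inner factors tau_(l+m)^-1 and tau_(m+l) cancel. *)
Lemma twisting_eltD m n :
  twisting_elt (n + m) = (shift m (twisting_elt n) * twisting_elt m)%g.
Proof.
apply: twist_group_eq => l a /=.
by rewrite (addrC l m) tauK addrA.
Qed.

Lemma twist_act_elt n a : twist_action (twisting_elt n) a = tau n a.
Proof.
rewrite /= /twist_act /= addr0; congr (tau n _).
(* The action uses the entry tau_n tau_0^-1 of index 0, and tau_0 is the identity. *)
by rewrite -[LHS](twist0 tau) tinvK.
Qed.

End TwistGroup.

(** * The cocycle twist and the Zhang twist *)

(** With coactions sum a_i (x) f_i t^n and sum b_j (x) f'_j t^m, the twisted product is the sum of
    the f_i(1) f'_j(gamma_n) a_i b_j. It factors as (1.a)(gamma_n.b). *)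
Lemma smash_cocycle_mul (k : fieldType) (A : gradedAlg k) (G : shiftGroup)
    (act : twisted_action A G) (rho : coaction A (smash_hopf k G))
    (gamma : int -> G) (gamma0 : gamma 0 = 1%g)
    (gammaD : forall m n, gamma (n + m) = (shift m (gamma n) * gamma m)%g) :
  (forall n a, homog A n a -> exists2 s, act_expansion act n a s &
    rho a = \sum_(p <- s) p.1 ⊗ smono n p.2) ->
  forall n a b, homog A n a ->
    cocycle_mul rho (smash_cocycle k gamma0 gammaD) a b = a * act (gamma n) b.
Proof.
move=> rhoE n a b ha.
move: b; apply: homog_eq => [||m b hb].
- exact: cocycle_linr.
- by move=> c u v; rewrite tact_linear mulrDr -scalerAr.
have [s [_ sE] rs] := rhoE _ _ ha; have [t [_ tE] rt] := rhoE _ _ hb.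
have F_bilin x1 y1 : bilin (fun x2 y2 =>
  (smash_form gamma (y1 ⊗ y2) : k) *: (x1 * x2 : A)) by lin.
rewrite /cocycle_mul rs rt tsum_sum; last by lin.
rewrite -[a in RHS](tact1 act) sE tE big_distrlr /=.
apply: eq_bigr => p _; rewrite tsum_tens; last by lin.
rewrite tsum_sum; last by lin.
apply: eq_bigr => q _; rewrite tsum_tens; last by lin.
by rewrite /= smash_formU -scalerAl -scalerAr scalerA.
Qed.

Theorem mainTheorem2 (k : fieldType) (m : nat) (hm : (2 <= m)%N)
  (A : gradedAlg k) (hA : homogeneous_alg m A) (tau : twisting_system A)
  (H : hopfAlg k) (rho : coaction A H) (hH : is_universal rho) :
  exists sigma : cocycle H,
    graded_iso (zhang_twist tau) (cocycle_twist rho sigma).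
Proof.
have [_ [N [x [x_homog x_basis x_gen _]]]] := hA.
pose act := twist_action A.
have x_act := act_expansion_basis act x_homog x_basis.
pose rho' := smash_coaction x_homog x_gen x_act.
(* Universality is applied to the smash product over the group of twisting families; [fE] makes its
   coaction factor through [rho]. *)
have [f [fP fE _]] := hH _ rho'.
pose sigma' := smash_cocycle k (twisting_elt0 tau) (twisting_eltD tau).
pose sigma := pullback_cocycle fP sigma'.
exists sigma.
(* Both twists have the underlying graded space of [A], so it remains to compare the products. By
   linearity the left argument may be taken homogeneous. *)
have mulE : cocycle_mul rho sigma =2 zhang_mul tau.
  move=> a b; rewrite (cocycle_mul_pullback fP sigma' fE).
  move: a; apply: homog_eq => [||n a ha].
  - exact: cocycle_linl.
  - exact: zhang_linl.
  rewrite (zhang_mul_homog tau b ha) (smash_cocycle_mul (act := act) _ _ _ b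
    ha).
    by rewrite twist_act_elt.
  move=> i c hc; have [s sE] := act_expansion_ex x_homog x_gen x_act hc.
  by exists s => //; apply: smash_coactE.
(* The isomorphism is the identity of [A]: the two twists share their unit and their projections,
   and [mulE] identifies their products. *)
pose idm : zhang_twist tau -> cocycle_twist rho sigma := id.
have idm_linear : linear idm by [].
have idm_monoid : monoid_morphism idm.
  by split=> // a b; apply/esym/mulE.
pose phi : {lrmorphism zhang_twist tau -> cocycle_twist rho sigma} := HB.pack
  idm
  (GRing.isLinear.Build k (zhang_twist tau) (cocycle_twist rho sigma) *:%R
    idm idm_linear)
  (GRing.isMonoidMorphism.Build (zhang_twist tau) (cocycle_twist rho sigma)
    idm idm_monoid).
by exists phi; split=> //; exists id.
Qed.
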